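(* Let $n\ge1$. Identify the variables $(\alpha_i,\beta_k,\beta'_k,\varphi_i)$ with $(a_i,b_i,t,f_i,g_i)$ by $$\frac{a_i}{b_i}=\alpha_{2i-1}\ (i=1,\ldots,n+1),\quad \frac{b_i}{a_{i+1}}=\alpha_{2i}\ (i=1,\ldots,n),\quad q^n\,t\prod_{i=1}^{n+1}a_ib_i=\beta_0,\quad t=\beta'_0,$$ $$f_i=\frac{1+\varphi_{2i}}{1+\varphi_0}\prod_{j=i}^n\varphi_{2j+1}\varphi_{2j+2},\qquad \frac{g_i}{b_i}=-\frac1{\varphi_{2i}}\qquad(i=1,\ldots,n).$$ Then the $q$-difference system $q$-$P_{(n+1,n+1)}$ $$f_i\overline{f}_i=q\,t\,\frac{F_iF_{i+1}\big(\frac{b_i}{\overline g_i}-1\big)(\overline g_i-a_{i+1})}{F_{n+1}F_1\big(\frac{b_0}{\overline g_0}-1\big)(\overline g_0-a_1)},\qquad g_i\overline g_i=\frac{F_{i+1}G_i}{F_iG_{i+1}}\qquad(i=1,\ldots,n),$$ with $\overline{a_i}=a_i$, $\overline{b_i}=b_i$, $\overline t=qt$, is equivalent to the action of the translation $\tau_1=s_1s'_1\pi^{-1}\pi'$ on $(a_i,b_i,t,f_i,g_i)$; that is, $\tau_1(a_i)=a_i$, $\tau_1(b_i)=b_i$, $\tau_1(t)=qt$, and $\overline f_i=\tau_1(f_i)$, $\overline g_i=\tau_1(g_i)$ are exactly the quantities determined by the system. Moreover, under the same identification the birational transformations $\tilde r_0,\ldots,\tilde r_{2n+1},\tilde\pi$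 are equivalent to (i.e. act in the same way as) $r_0,\ldots,r_{2n+1},s'_1\pi$ respectively.
   Context: **The affine Weyl group side.** $\alpha_i,\varphi_i$ $(i\in\mathbb{Z}_{2n+2})$ are $4n+4$ independent variables (indices mod $2n+2$), $q=\prod_{i=0}^{2n+1}\alpha_i$, $\beta_0=\prod_{i=0}^n\frac{\varphi_{2i}\alpha_{2i+1}}{\varphi_{2i+1}}$, $\beta'_0=\prod_{i=0}^n\varphi_{2i}\varphi_{2i+1}$, $\beta_1=q/\beta_0$, $\beta'_1=q/\beta'_0$. The following are automorphisms of $\mathbb{Q}(\alpha_i,\varphi_i)$; products are composed as birational maps of tuples from right to left, i.e. as field automorphisms $(fg)(x)=g(f(x))$. $$r_j(\alpha_j)=\alpha_j^{-1},\ r_j(\alpha_{j\pm1})=\alpha_{j\pm1}\alpha_j,\ r_j(\alpha_i)=\alpha_i\ (i\ne j,j\pm1),\quad r_j(\varphi_i)=\varphi_i\,\alpha_j^{-\delta_{i,j}+\delta_{i,j+1}}\Big(\tfrac{\alpha_j+\varphi_j}{1+\varphi_j}\Big)^{\delta_{i,j-1}-\delta_{i,j+1}};$$ $s_1,s'_1$ fix all $\alpha_i$ and $$s_1(\varphi_{2i})=\alpha_{2i}\varphi_{2i+1}\frac{S_{2i+2}}{S_{2i}},\quad s_1(\varphi_{2i+1})=\frac{\varphi_{2i+2}}{\alpha_{2i+2}}\frac{S_{2i+1}}{S_{2i+3}},\quad s'_1(\varphi_i)=\frac{\alpha_i\alpha_{i+1}}{\varphi_{i+1}}\frac{S'_i}{S'_{i+2}},$$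 where $S_{2i}=\sum_{j=0}^n\big(\prod_{k=0}^{j-1}\frac{\alpha_{2i+2k}}{\varphi_{2i+2k}}\varphi_{2i+2k+1}\big)\big(1+\frac{\alpha_{2i+2j}}{\varphi_{2i+2j}}\big)$, $S_{2i+1}=\sum_{j=0}^n\big(\prod_{k=0}^{j-1}\varphi_{2i+2k+1}\frac{\alpha_{2i+2k+2}}{\varphi_{2i+2k+2}}\big)(1+\varphi_{2i+2j+1})$, $S'_i=\sum_{j=0}^{2n+1}\prod_{k=0}^{j-1}\frac{\varphi_{i+k}}{\alpha_{i+k}}$; and $$\pi(\alpha_i)=\alpha_{i+1},\ \pi(\varphi_i)=\varphi_{i+1},\qquad \pi'(\alpha_i)=\alpha_{i+1},\ \pi'(\varphi_i)=\alpha_{i+1}/\varphi_{i+1}.$$ On parameters, $\tau_1(\alpha_i)=\alpha_i$, $\tau_1(\beta_0)=q\beta_0$, $\tau_1(\beta'_0)=q\beta'_0$. **The $q$-$P_{(n+1,n+1)}$ side.** $a_i,b_i$ $(1\le i\le n+1)$ are parameters, $t$ the independent variable, $f_i,g_i$ $(1\le i\le n)$ dependent variables, and $$b_0=q\,b_{n+1},\quad f_0=t,\quad g_0=\frac1{q^{\frac{n-2}2}t\,g_1\cdots g_n},\qquad \overline{x(t)}=x(qt)$$ (so $\overline g_0=1/(q^{n/2}t\,\overline g_1\cdots\overline g_n)$). For $i=1,\ldots,n+1$, $$F_i=\sum_{j=1}^{i-1}f_j+t\sum_{j=i}^nf_j+t,$$ $$G_i=\sum_{j=i}^n\prod_{k=i}^{j-1}b_ka_{k+1}\frac{\prod_{l=j+1}^ng_l}{\prod_{l=1}^{j-1}g_l}f_j+q^{\frac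 n2}t\prod_{k=i}^nb_ka_{k+1}+q^{n-1}t\sum_{j=1}^{i-1}\prod_{k=0}^{j-1}b_ka_{k+1}\prod_{k=i}^nb_ka_{k+1}\frac{\prod_{l=j+1}^ng_l}{\prod_{l=1}^{j-1}g_l}f_j.$$ **Identification.** Given $(\alpha,\varphi)$, the $a_i,b_i$ are determined only up to taking roots ($a_i^{2n+2},b_i^{2n+2}$ are rational in $\alpha_j,\beta_0,\beta'_0$); roots (including $q^{1/2}$) are chosen so that also $g_0/b_0=-1/\varphi_0$. Equivalently, one has $\alpha_0=b_0/a_1$, $\varphi_{2i}=-b_i/g_i$ $(i=0,\ldots,n)$, $\varphi_1=-\frac{g_0(b_1-g_1)}{b_1(b_0-g_0)}\frac t{f_1}$, $\varphi_{2i+1}=-\frac{g_i(b_{i+1}-g_{i+1})}{b_{i+1}(b_i-g_i)}\frac{f_i}{f_{i+1}}$ $(1\le i\le n-1)$, $\varphi_{2n+1}=-\frac{g_n(b_0-g_0)}{b_0(b_n-g_n)}f_n$. The transformations are extended to the roots so that $\tau_1$ fixes $a_i,b_i$ and $r_j$, $s'_1\pi$ act on $a_i,b_i$ as $\tilde r_j$, $\tilde\pi$ below; $q$ and its roots are fixed by everything. **The transformations $\tilde r_j$.** $\tilde r_{2j}$ $(0\le j\le n)$ exchanges $b_j$ and $a_{j+1}$ (for $j=0$: $b_0=qb_{n+1}\leftrightarrow a_1$), and fixes the other $b_i,a_{i+1}$ $(0\le i\le n,\ i\neq j)$, $t$, and all $f_i,g_i$. $\tilde r_{2j+1}$ $(0\le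 j\le n)$ exchanges $a_{j+1}$ and $b_{j+1}$, fixes the other parameters and $t$, and $$\tilde r_1(f_i)=f_i\Big(\tfrac{R_1^{a,a,a}}{R_1^{b,a,b}}\Big)^{\delta_{i,1}}\Big(\tfrac{R_1^{b,a,a}}{R_1^{b,a,b}}\Big)^{1-\delta_{i,1}},\quad \tilde r_1(g_i)=g_i\Big(\tfrac{R_1^{b,a,a}}{R_1^{b,b,b}}\Big)^{\delta_{i,1}},$$ $$\tilde r_{2j+1}(f_i)=f_i\Big(\tfrac{R_{j+1}^{b,a,b}}{R_{j+1}^{b,a,a}}\Big)^{\delta_{i,j}}\Big(\tfrac{R_{j+1}^{a,a,a}}{R_{j+1}^{b,a,a}}\Big)^{\delta_{i,j+1}},\quad \tilde r_{2j+1}(g_i)=g_i\Big(\tfrac{R_{j+1}^{b,b,b}}{R_{j+1}^{b,a,a}}\Big)^{\delta_{i,j}-\delta_{i,j+1}}\quad(1\le j\le n-1),$$ $$\tilde r_{2n+1}(f_i)=f_i\Big(\tfrac{R_{n+1}^{b,a,b}}{R_{n+1}^{a,a,a}}\Big)^{\delta_{i,n}}\Big(\tfrac{R_{n+1}^{b,a,a}}{R_{n+1}^{a,a,a}}\Big)^{1-\delta_{i,n}},\quad \tilde r_{2n+1}(g_i)=g_i\Big(\tfrac{R_{n+1}^{b,b,b}}{R_{n+1}^{b,a,a}}\Big)^{\delta_{i,n}},$$ for $1\le i\le n$, where for letters $x,y,w\in\{a,b\}$ $$R_j^{x,y,w}=(g_j-x_j)\frac1{f_j}+\Big(y_j\frac{b_{j-1}}{g_{j-1}}-w_j\Big)\frac1{f_{j-1}}\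 (1\le j\le n),\quad R_{n+1}^{x,y,w}=\frac1q(g_0-q\,x_{n+1})+\Big(y_{n+1}\frac{b_n}{g_n}-w_{n+1}\Big)\frac1{f_n}.$$ **The transformation $\tilde\pi$.** With $q^{\rho_1}=(q^na_1b_1\cdots a_{n+1}b_{n+1})^{\frac1{n+1}}$, $$\tilde\pi(a_i)=\frac{b_i}{q^{\rho_1}}\ (1\le i\le n+1),\quad \tilde\pi(b_i)=\frac{a_{i+1}}{q^{\rho_1}}\ (1\le i\le n),\quad \tilde\pi(b_{n+1})=\frac{a_1}{q^{\rho_1+1}},\quad \tilde\pi(\rho_1)=-\rho_1-\frac1{n+1},\quad \tilde\pi(t)=\frac{q^2}t,$$ $$\tilde\pi(f_i)=\frac{q^2}t\frac{(g_iR_i^*-b_{i+1}R_{i+1}^* )(b_{i+1}-g_{i+1})(R_{i+1}^*+1-\frac tq)f_1}{(g_0R_0^*-b_1R_1^* )(b_1-g_1)(R_1^*+1-\frac tq)f_{i+1}},\quad \tilde\pi(g_i)=\frac{a_{i+1}}{q^{\rho_1}}\frac{b_{i+1}R_{i+1}^*}{g_iR_i^*}\quad(1\le i\le n-1),$$ $$\tilde\pi(f_n)=q\frac{(g_nR_n^*-b_{n+1}R_0^* )(b_0-g_0)(R_0^*+1-\frac tq)f_1}{(g_0R_0^*-b_1R_1^* )(b_1-g_1)(R_1^*+1-\frac tq)f_0},\quad \tilde\pi(g_n)=\frac{a_{n+1}}{q^{\rho_1}}\frac{b_{n+1}R_0^*}{g_nR_n^*},$$ where for $i=0,\ldots,n$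 $$R_i^*=\frac{f_i}{b_i-g_i}\Big(\sum_{j=0}^{i-1}\frac{\frac tq(1-\frac{a_{j+1}}{g_j})(b_j-g_j)}{f_j}+\frac{(\frac tq-\frac{a_{i+1}}{g_i})(b_i-g_i)}{f_i}+\sum_{j=i+1}^n\frac{(1-\frac{a_{j+1}}{g_j})(b_j-g_j)}{f_j}\Big).$$ *)

(* Defs.v *)
From HB Require Import structures.
From mathcomp Require Import all_boot all_order all_algebra.
From mathcomp.multinomials Require Import mpoly.
Set Implicit Arguments. Unset Strict Implicit. Unset Printing Implicit Defensive.
Import GRing.Theory.
Local Open Scope ring_scope.

(* Indices of alpha and phi live in 'I_(2 * n).+2 with its ring structure of
   integers modulo 2n+2, so that [k%:R] is the class of k and i + 1, i - 1 are
   taken modulo 2n+2. *)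
Record apoint (n : nat) (F : Type) := APoint {
  alpha : 'I_(2 * n).+2 -> F;
  phi   : 'I_(2 * n).+2 -> F
}.

Definition apoint_map n (F F' : Type) (h : F -> F') (X : apoint n F) :
    apoint n F' :=
  APoint (fun i => h (alpha X i)) (fun i => h (phi X i)).

(* The field Q(alpha_i, phi_i) in 4n+4 independent variables: the first 2n+2
   variables are the alpha_i, the last 2n+2 the phi_i. *)
Definition QAlphaPhi (n : nat) : fieldType :=
  {fraction {mpoly rat[(2 * n).+2 + (2 * n).+2]}}.

Definition generators (n : nat) : apoint n (QAlphaPhi n) :=
  APoint (fun i => tofrac ('X_(lshift (2 * n).+2 i)
                            : {mpoly rat[(2 * n).+2 + (2 * n).+2]}))
         (fun i => tofrac ('X_(rshift (2 * n).+2 i)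
                            : {mpoly rat[(2 * n).+2 + (2 * n).+2]})).

Section AffineWeylGroup.
Variables (n : nat) (F : fieldType).
Implicit Types (X : apoint n F) (i j m : 'I_(2 * n).+2).

Definition qprod X : F := \prod_i alpha X i.
Definition beta0 X : F :=
  \prod_(i < n.+1)
    (phi X (2 * i)%:R * alpha X (2 * i).+1%:R / phi X (2 * i).+1%:R).
Definition beta0' X : F :=
  \prod_(i < n.+1) (phi X (2 * i)%:R * phi X (2 * i).+1%:R).

(* An automorphism T of Q(alpha, phi) is given by the birational map of tuples
   (alpha, phi) |-> (T(alpha), T(phi)), that is, T(x) is the pull-back of the
   rational function x along this map.  A product f g is the composite of maps
   f o g (g is applied first), in accordance with (f g)(x) = g(f(x)). *)

Definition r j X : apoint n F :=
  APoint
    (fun i => if i == j then (alpha X j)^-1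
              else if (i == j + 1) || (i == j - 1) then alpha X i * alpha X j
              else alpha X i)
    (fun i => phi X i
       * alpha X j ^ (- (i == j)%:Z + (i == j + 1)%:Z)
       * ((alpha X j + phi X j) / (1 + phi X j))
           ^ ((i == j - 1)%:Z - (i == j + 1)%:Z)).

(* S_m for m even and for m odd, respectively *)
Definition Seven X m : F :=
  \sum_(j < n.+1)
    (\prod_(k < j) (alpha X (m + (2 * k)%:R) / phi X (m + (2 * k)%:R)
                    * phi X (m + (2 * k).+1%:R)))
    * (1 + alpha X (m + (2 * j)%:R) / phi X (m + (2 * j)%:R)).
Definition Sodd X m : F :=
  \sum_(j < n.+1)
    (\prod_(k < j) (phi X (m + (2 * k)%:R)
                    * (alpha X (m + (2 * k).+1%:R) / phi X (m + (2 * k).+1%:R))))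
    * (1 + phi X (m + (2 * j)%:R)).
Definition S' X m : F :=
  \sum_(j < (2 * n).+2) \prod_(k < j) (phi X (m + k%:R) / alpha X (m + k%:R)).

Definition s1 X : apoint n F :=
  APoint (alpha X)
    (fun m => if odd m
       then phi X (m + 1) / alpha X (m + 1) * (Sodd X m / Sodd X (m + 2%:R))
       else alpha X m * phi X (m + 1) * (Seven X (m + 2%:R) / Seven X m)).

Definition s1' X : apoint n F :=
  APoint (alpha X)
    (fun i => alpha X i * alpha X (i + 1) / phi X (i + 1)
              * (S' X i / S' X (i + 2%:R))).

Definition pi_ X : apoint n F :=
  APoint (fun i => alpha X (i + 1)) (fun i => phi X (i + 1)).

Definition pi_inv X : apoint n F :=
  APoint (fun i => alpha X (i - 1)) (fun i => phi X (i - 1)).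

Definition pi_' X : apoint n F :=
  APoint (fun i => alpha X (i + 1)) (fun i => alpha X (i + 1) / phi X (i + 1)).

Definition tau1 X : apoint n F := s1 (s1' (pi_inv (pi_' X))).

End AffineWeylGroup.

(* The tuple (a_i, b_i, t, f_i, g_i), together with qrho = q^rho_1.  Sequences
   keep their 1-based indices: only a_i, b_i for 1 <= i <= n+1 and f_i, g_i for
   1 <= i <= n are meaningful, and no definition below uses other values. *)
Record qpoint (F : Type) := QPoint {
  qa : nat -> F;
  qb : nat -> F;
  qt : F;
  qf : nat -> F;
  qg : nat -> F;
  qrho : F
}.

Section QPainleve.
Variables (n : nat) (F : fieldType).
(* qhalf stands for q^(1/2) and qroot for q^(1/(n+1)) *)
Variables (q qhalf qroot : F).
Implicit Types (Y : qpoint F) (i j : nat).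

Definition b_ Y i : F := if i == 0%N then q * qb Y n.+1 else qb Y i.
Definition f_ Y i : F := if i == 0%N then qt Y else qf Y i.
Definition g_ Y i : F :=
  if i == 0%N
  then (qhalf ^ (n%:Z - 2) * qt Y * \prod_(1 <= k < n.+1) qg Y k)^-1
  else qg Y i.

Definition identified (X : apoint n F) Y : Prop :=
  [/\ [/\ q = qprod X,
          forall i, (1 <= i <= n.+1)%N ->
            qa Y i / qb Y i = alpha X (2 * i).-1%:R
        & forall i, (1 <= i <= n)%N ->
            qb Y i / qa Y i.+1 = alpha X (2 * i)%:R],
      [/\ q ^+ n * qt Y * \prod_(1 <= i < n.+2) (qa Y i * qb Y i) = beta0 X,
          qt Y = beta0' X
        & qrho Y ^+ n.+1 = q ^+ n * \prod_(1 <= i < n.+2) (qa Y i * qb Y i)],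
      forall i, (1 <= i <= n)%N ->
        qf Y i = (1 + phi X (2 * i)%:R) / (1 + phi X 0)
          * \prod_(i <= j < n.+1) (phi X (2 * j).+1%:R * phi X (2 * j).+2%:R),
      forall i, (1 <= i <= n)%N -> qg Y i / qb Y i = - (phi X (2 * i)%:R)^-1
    & g_ Y 0 / b_ Y 0 = - (phi X 0)^-1].

Definition F_ Y i : F :=
  \sum_(1 <= j < i) qf Y j + qt Y * \sum_(i <= j < n.+1) qf Y j + qt Y.

Definition G_ Y i : F :=
  let gquot j := (\prod_(j.+1 <= l < n.+1) qg Y l)
                 / (\prod_(1 <= l < j) qg Y l) in
  let ba k := b_ Y k * qa Y k.+1 in
  \sum_(i <= j < n.+1) (\prod_(i <= k < j) ba k) * gquot j * qf Y j
  + qhalf ^+ n * qt Y * \prod_(i <= k < n.+1) ba k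
  + q ^+ n.-1 * qt Y
    * \sum_(1 <= j < i) (\prod_(0 <= k < j) ba k)
        * (\prod_(i <= k < n.+1) ba k) * gquot j * qf Y j.

(* The tuple at qt: a, b unchanged, t replaced by qt, and f, g replaced by
   their shifts.  In particular its g_0 is the shift of g_0. *)
Definition shifted Y (fbar gbar : nat -> F) : qpoint F :=
  QPoint (qa Y) (qb Y) (q * qt Y) fbar gbar (qrho Y).

Definition qP_system Y (fbar gbar : nat -> F) : Prop :=
  let Ybar := shifted Y fbar gbar in
  forall i, (1 <= i <= n)%N ->
    qf Y i * fbar i
      = q * qt Y
        * ((F_ Y i * F_ Y i.+1 * (b_ Y i / gbar i - 1) * (gbar i - qa Y i.+1))
           / (F_ Y n.+1 * F_ Y 1 * (b_ Y 0 / g_ Ybar 0 - 1)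
              * (g_ Ybar 0 - qa Y 1)))
    /\ qg Y i * gbar i = (F_ Y i.+1 * G_ Y i) / (F_ Y i * G_ Y i.+1).

(* As b_0 = q b_(n+1), exchanging b_0 and a_1 means b_(n+1) |-> a_1 / q. *)
Definition rt_even j Y : qpoint F :=
  QPoint
    (fun i => if i == j.+1 then b_ Y j else qa Y i)
    (fun i => if j == 0%N then (if i == n.+1 then qa Y 1 / q else qb Y i)
              else if i == j then qa Y j.+1 else qb Y i)
    (qt Y) (qf Y) (qg Y) (qrho Y).

(* R_j^{x,y,w}, the letters being passed as the sequences x, y, w *)
Definition R_ Y (x y w : nat -> F) j : F :=
  if j == n.+1
  then q^-1 * (g_ Y 0 - q * x n.+1)
       + (y n.+1 * (b_ Y n / g_ Y n) - w n.+1) / f_ Y n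
  else (g_ Y j - x j) / f_ Y j
       + (y j * (b_ Y j.-1 / g_ Y j.-1) - w j) / f_ Y j.-1.

Definition rt_odd j Y : qpoint F :=
  let a := qa Y in
  let b := qb Y in
  let R x y w := R_ Y x y w j.+1 in
  let fac_f i :=
    if j == 0%N then
      if i == 1%N then R a a a / R b a b else R b a a / R b a b
    else if j == n then
      if i == n then R b a b / R a a a else R b a a / R a a a
    else
      if i == j then R b a b / R b a a
      else if i == j.+1 then R a a a / R b a a else 1 in
  let fac_g i :=
    if j == 0%N then
      if i == 1%N then R b a a / R b b b else 1
    else if j == n then
      if i == n then R b b b / R b a a else 1
    else
      (R b b b / R b a a) ^ ((i == j)%:Z - (i == j.+1)%:Z) in
  QPoint
    (fun i => if i == j.+1 then b i else a i)
    (fun i => if i == j.+1 then a i else b i)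
    (qt Y)
    (fun i => qf Y i * fac_f i)
    (fun i => qg Y i * fac_g i)
    (qrho Y).

Definition rt (j : nat) Y : qpoint F :=
  if odd j then rt_odd j./2 Y else rt_even j./2 Y.

Definition Rstar Y i : F :=
  let tq := qt Y / q in
  f_ Y i / (b_ Y i - g_ Y i)
  * (\sum_(0 <= j < i)
       tq * (1 - qa Y j.+1 / g_ Y j) * (b_ Y j - g_ Y j) / f_ Y j
     + (tq - qa Y i.+1 / g_ Y i) * (b_ Y i - g_ Y i) / f_ Y i
     + \sum_(i.+1 <= j < n.+1)
         (1 - qa Y j.+1 / g_ Y j) * (b_ Y j - g_ Y j) / f_ Y j).

Definition pit Y : qpoint F :=
  let a := qa Y in
  let b := b_ Y in
  let f := f_ Y in
  let g := g_ Y in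
  let t := qt Y in
  let R := Rstar Y in
  let p := qrho Y in
  let den := (g 0%N * R 0%N - b 1%N * R 1%N) * (b 1%N - g 1%N)
             * (R 1%N + 1 - t / q) in
  QPoint
    (fun i => b i / p)
    (fun i => if i == n.+1 then a 1%N / (p * q) else a i.+1 / p)
    (q ^+ 2 / t)
    (fun i => if i == n
       then q * (((g n * R n - b n.+1 * R 0%N) * (b 0%N - g 0%N)
                  * (R 0%N + 1 - t / q) * f 1%N) / (den * f 0%N))
       else q ^+ 2 / t
            * (((g i * R i - b i.+1 * R i.+1) * (b i.+1 - g i.+1)
                * (R i.+1 + 1 - t / q) * f 1%N) / (den * f i.+1)))
    (fun i => if i == n
       then a n.+1 / p * (b n.+1 * R 0%N / (g n * R n))
       else a i.+1 / p * (b i.+1 * R i.+1 / (g i * R i)))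
    (p * qroot)^-1.

End QPainleve.

(* If a ring endomorphism [h] of F sends X to X' and the chosen roots
   accordingly, then [identified X' Y'] says that Y' lists the images of
   t, f_i, g_i under [h]. *)
Lemma identified_image (n : nat) (F : fieldType) (q qhalf : F)
    (h : {rmorphism F -> F}) (X X' : apoint n F) (Y Y' : qpoint F) :
  identified q qhalf X Y -> identified q qhalf X' Y' ->
  (forall i, h (alpha X i) = alpha X' i) ->
  (forall i, h (phi X i) = phi X' i) ->
  (forall i, (1 <= i <= n)%N -> qb Y i != 0 /\ h (qb Y i) = qb Y' i) ->
  h (qt Y) = qt Y'
  /\ forall i, (1 <= i <= n)%N ->
       h (qf Y i) = qf Y' i /\ h (qg Y i) = qg Y' i.
Proof.
move=> [_ [_ tE _] fE gE _] [_ [_ tE' _] fE' gE' _] _ hphi hb; split.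
  rewrite tE tE' /beta0' rmorph_prod; apply: eq_bigr => i _.
  by rewrite rmorphM !hphi.
move=> i hi; have [b0 bE] := hb i hi; split.
  rewrite fE // fE' // !rmorphM fmorphV !rmorphD !rmorph1 !hphi rmorph_prod.
  by congr (_ * _); apply: eq_bigr => j _; rewrite rmorphM !hphi.
have b0' : qb Y' i != 0 by rewrite -bE fmorph_eq0.
rewrite -[qg Y i](divfK b0) -[qg Y' i](divfK b0') gE // gE' //.
by rewrite rmorphM rmorphN fmorphV hphi bE.
Qed.

(* Main.v *)
Require Import Defs.
From HB Require Import structures.
From mathcomp Require Import all_boot all_order all_algebra.
From mathcomp.multinomials Require Import mpoly.
From mathcomp Require Import ring zify.
From Stdlib Require Import FunctionalExtensionality.
Set Implicit Arguments. Unset Strict Implicit. Unset Printing Implicit Defensive.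
Import GRing.Theory.
Local Open Scope ring_scope.

(* On independent variables no subtraction-free expression in the alpha_i and
   phi_i vanishes, which takes care of all denominators. Condition [identified]
   is equivalent to relations between neighbouring indices ([matched]), so that
   r_j only has to be checked next to j.
   For s'_1 pi one finds R*_i = phi_(2i)/alpha_(2i) S'_(2i+1) and
   R*_i + 1 - t/q = S'_(2i).
   For tau_1, the sums F_i and G_i are, up to explicit monomial factors, cyclic
   sums T_(2i) and V_i; the sums S_(2i) entering s_1 factor as
   (T_(2i+1)/T_(2i)) V_i, and the sums S_(2i+1) drop out of the equation for f_i
   through S_(2i) + phi_(2i+1) S_(2i+2) = (1 + alpha_(2i)/phi_(2i)) S_(2i+1). *)

(** * Cyclic sums *)

(** The sums in the statement that split into two halves, one of them weighted by t, t/q or q^(n-1)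
    t times parameters, are unrolled cyclic sums: one full period starting at i, where the part
    wrapping past n picks up the product of the ratios over a period. The isolated terms of F_i and
    G_i are their terms of index 0, since f_0 = t. Factors h(m+1)/h(m) in the ratios can be moved
    into the weights, which is how S_(2i) factors; in a product over a full period they cancel,
    which is how q and t are followed through the transformations. The delicate variable is g_0: it
    is defined through the product of all g_i and a half-integer power of q, so whenever g_1, ...,
    g_n change, its relation to phi_0 has to be recovered from a product of all the other relations,
    sign included. For tau_1 the equivalence is a uniqueness argument: the identification and the
    system each determine the values at 1 <= i <= n, so a single solution common to both is
    enough. *)

Section CyclicSums.
Variable F : fieldType.
Implicit Types (c d h x : nat -> F) (M i j k : nat).

Definition cycsum M c d i : F :=
  \sum_(j < M) (\prod_(l < j) c (i + l)%N) * d (i + j)%N.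

Lemma eq_cycsum M c c' d d' i :
  c =1 c' -> d =1 d' -> cycsum M c d i = cycsum M c' d' i.
Proof.
move=> ec ed; apply: eq_bigr => j _; rewrite ed; congr (_ * _).
by apply: eq_bigr => l _; rewrite ec.
Qed.

(** Moving the start by one step divides the common terms by [c i]; only the first term and the term
    entering at the far end survive. *)
Lemma cycsum_rec M c d i :
  cycsum M c d i - c i * cycsum M c d i.+1
  = d i - (\prod_(l < M) c (i + l)%N) * d (i + M)%N.
Proof.
rewrite /cycsum; elim: M => [|M IH].
  by rewrite !big_ord0 mulr0 subr0 mul1r addn0 subrr.
rewrite 2![\sum_(j < M.+1) _]big_ord_recr /= mulrDr opprD addrACA IH.
have -> : \prod_(l < M.+1) c (i + l)%N = c i * \prod_(l < M) c (i.+1 + l)%N.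
  rewrite big_ord_recl addn0; congr (_ * _).
  by apply: eq_bigr => l _; rewrite /= /bump /= addnA addn1.
by rewrite addSnnS; ring.
Qed.

Lemma prod_periodic M c i :
  (forall k, c (k + M)%N = c k) -> \prod_(l < M) c (i + l)%N = \prod_(l < M) c l.
Proof.
move=> per; elim: i => [//|i IH]; rewrite -IH; case: M per {IH} => [|M] per.
  by rewrite !big_ord0.
rewrite [LHS]big_ord_recr [RHS]big_ord_recl mulrC addn0 /= addSnnS per.
congr (_ * _); apply: eq_bigr => l _.
by rewrite /= /bump /= addSnnS.
Qed.

Lemma cycsum_periodic M c d i :
  (forall k, c (k + M)%N = c k) -> (forall k, d (k + M)%N = d k) ->
  cycsum M c d (i + M) = cycsum M c d i.
Proof.
move=> pc pd; apply: eq_bigr => j _; rewrite addnAC pd; congr (_ * _).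
by apply: eq_bigr => l _; rewrite addnAC pc.
Qed.

Lemma telescope_ratio h i j : (forall k, h k != 0) ->
  \prod_(l < j) (h (i + l).+1 / h (i + l)%N) = h (i + j)%N / h i.
Proof.
move=> h0; elim: j => [|j IH]; first by rewrite big_ord0 addn0 divff.
by rewrite big_ord_recr /= IH addnS; field; rewrite !h0.
Qed.

(** The quotients of [h] telescope inside every partial product to h(i+j)/h(i). *)
Lemma cycsum_gauge M c d h i : (forall k, h k != 0) ->
  cycsum M (fun m => c m * (h m.+1 / h m)) d i
  = cycsum M c (fun m => d m * h m) i / h i.
Proof.
move=> h0; rewrite /cycsum big_distrl /=; apply: eq_bigr => j _.
by rewrite big_split /= telescope_ratio //; ring.
Qed.

(** [D] is a primitive of the ratios, so the partial products become D(i+j)/D(i). [D] itself is only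
    quasi-periodic: bringing the indices beyond M back by one period costs the full product of [c].
    This is the common shape of F_i, G_i and R*_i. *)
Lemma cycsum_unfold M c d D i : (i <= M)%N ->
  (forall k, c (k + M)%N = c k) -> (forall k, d (k + M)%N = d k) ->
  (forall k, D k.+1 = D k * c k) ->
  D i * cycsum M c d i
  = \sum_(i <= j < M) D j * d j
    + (\prod_(l < M) c l) * \sum_(0 <= j < i) D j * d j.
Proof.
move=> leiM pc pd recD.
have E k j : D k * \prod_(l < j) c (k + l)%N = D (k + j)%N.
  elim: j => [|j IH]; first by rewrite big_ord0 mulr1 addn0.
  by rewrite big_ord_recr /= mulrA IH addnS recD.
transitivity (\sum_(i <= j < i + M) D j * d j).
  rewrite -{3}[i]add0n [in RHS]big_addn addKn big_mkord big_distrr /=.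
  by apply: eq_bigr => j _; rewrite mulrA E addnC.
rewrite (big_cat_nat leiM) ?leq_addl //; congr (_ + _).
rewrite -{1}[M]add0n big_addn addnK big_distrr /=; apply: eq_bigr => j _.
by rewrite pd -E prod_periodic //; ring.
Qed.

(** Grouping the terms two by two turns a sum over all indices modulo 2n+2, such as S', into one
    over n+1 indices, comparable with the sums in f and g. *)
Lemma cycsum_pair M x i :
  cycsum (2 * M) x (fun=> 1) (2 * i)
  = cycsum M (fun m => x (2 * m)%N * x (2 * m).+1)
             (fun m => 1 + x (2 * m)%N) i.
Proof.
have E j : \prod_(l < 2 * j) x (2 * i + l)%N
    = \prod_(l < j) (x (2 * (i + l))%N * x (2 * (i + l)).+1).
  elim: j => [|j IH]; first by rewrite muln0 !big_ord0.
  rewrite mulnS !big_ord_recr /= IH -mulrA; congr (_ * (_ * _)).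
    by congr x; lia.
  by congr x; lia.
rewrite /cycsum; elim: M => [|M IH]; first by rewrite muln0 !big_ord0.
rewrite mulnS !big_ord_recr /= IH E -addrA; congr (_ + _).
have -> : (2 * i + 2 * M = 2 * (i + M))%N by lia.
by ring.
Qed.

Lemma cycsumB M c d d' i :
  cycsum M c d i - cycsum M c d' i = cycsum M c (fun m => d m - d' m) i.
Proof. by rewrite -sumrB; apply: eq_bigr => j _; rewrite mulrBr. Qed.

Lemma cycsum_telescope M c i :
  cycsum M c (fun m => c m - 1) i = \prod_(l < M) c (i + l)%N - 1.
Proof.
rewrite /cycsum; elim: M => [|M IH]; first by rewrite !big_ord0 subrr.
by rewrite !big_ord_recr /= IH; ring.
Qed.

Lemma prod_ratio_periodic M x h : (forall k, h k != 0) -> h M = h 0 ->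
  \prod_(l < M) (x l * (h l.+1 / h l)) = \prod_(l < M) x l.
Proof.
move=> h0 hM; rewrite big_split /=; have /= -> := telescope_ratio 0 M h0.
by rewrite add0n hM divff // mulr1.
Qed.

(** Gauging [So] by [u] gives it the ratios u w of [Se]. The weights of u So - Se are then u w - 1,
    so this difference telescopes, and its full product cancels the one in the recurrence for
    [Se]. *)
Lemma cycsum_s1 M u w i : (forall k, u k != 0) ->
  (forall k, u (k + M)%N = u k) ->
  let Se := cycsum M (fun m => u m * w m) (fun m => 1 + u m) in
  let So := cycsum M (fun m => w m * u m.+1) (fun m => 1 + w m) in
  Se i + w i * Se i.+1 = (1 + u i) * So i.
Proof.
move=> u0 pu Se So.
have SoE : So i = cycsum M (fun m => u m * w m) (fun m => (1 + w m) * u m) i / u i.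
  rewrite -cycsum_gauge //; apply: eq_cycsum => // m.
  by rewrite mulrC mulrACA [u m * _]mulrC mulrAC -mulrA; field; rewrite u0.
have D : u i * So i - Se i = \prod_(l < M) (u (i + l)%N * w (i + l)%N) - 1.
  rewrite SoE mulrCA divff // mulr1 cycsumB -(cycsum_telescope _ (fun m => u m * w m)).
  by apply: eq_cycsum => // m; ring.
have R : Se i - u i * w i * Se i.+1
    = (1 + u i) - (\prod_(l < M) (u (i + l)%N * w (i + l)%N)) * (1 + u i).
  by rewrite /Se cycsum_rec pu.
apply: (mulfI (u0 i)).
transitivity ((1 + u i) * Se i - (Se i - u i * w i * Se i.+1)); first by ring.
by rewrite R mulrCA; move: D => /eqP; rewrite subr_eq => /eqP ->; ring.
Qed.

End CyclicSums.

(** * Indices in nat, base change and generic points *)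

Lemma val_natr n k : ((k%:R : 'I_(2 * n).+2) : nat) = (k %% (2 * n).+2)%N.
Proof. by rewrite Zp_nat. Qed.

Lemma odd_natr n k : odd (k%:R : 'I_(2 * n).+2) = odd k.
Proof.
rewrite val_natr {2}(divn_eq k (2 * n).+2) oddD oddM /= mul2n odd_double.
by rewrite andbF.
Qed.

Lemma natr_period n k : (k + (2 * n).+2)%:R = k%:R :> 'I_(2 * n).+2.
Proof. by apply: val_inj; rewrite /= !val_natr modnDr. Qed.

Lemma natr_eq n k l :
  (k%:R == l%:R :> 'I_(2 * n).+2) = (k == l %[mod (2 * n).+2]).
Proof. by rewrite -val_eqE /= !val_natr. Qed.

Section NatIndices.
Variables (n : nat) (F : fieldType).
Implicit Types (X : apoint n F) (i j k : nat).

Definition al X k : F := alpha X k%:R.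
Definition ph X k : F := phi X k%:R.

Lemma al_period X k : al X (k + (2 * n).+2) = al X k.
Proof. by rewrite /al natr_period. Qed.

Lemma ph_period X k : ph X (k + (2 * n).+2) = ph X k.
Proof. by rewrite /ph natr_period. Qed.

Lemma al_even_period X k : al X (2 * (k + n.+1)) = al X (2 * k).
Proof. by rewrite mulnDr mulnS al_period. Qed.

Lemma ph_even_period X k : ph X (2 * (k + n.+1)) = ph X (2 * k).
Proof. by rewrite mulnDr mulnS ph_period. Qed.

Lemma al_odd_period X k : al X (2 * (k + n.+1)).+1 = al X (2 * k).+1.
Proof. by rewrite mulnDr mulnS -addSn al_period. Qed.

Lemma ph_odd_period X k : ph X (2 * (k + n.+1)).+1 = ph X (2 * k).+1.
Proof. by rewrite mulnDr mulnS -addSn ph_period. Qed.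

Lemma qprodE X : qprod X = \prod_(k < (2 * n).+2) al X k.
Proof.
by apply: eq_bigr => k _; rewrite /al -[k in LHS]natr_Zp.
Qed.

Lemma prod_pairs (x : nat -> F) m :
  \prod_(k < 2 * m) x k = \prod_(i < m) (x (2 * i)%N * x (2 * i).+1).
Proof.
elim: m => [|m IH]; first by rewrite muln0 !big_ord0.
by rewrite mulnS !big_ord_recr /= IH !mulrA.
Qed.

Lemma qprod_pairs X :
  qprod X = \prod_(i < n.+1) (al X (2 * i) * al X (2 * i).+1).
Proof. by rewrite qprodE -prod_pairs mulnS. Qed.

Lemma beta0'E X : beta0' X = \prod_(k < (2 * n).+2) ph X k.
Proof. by have := prod_pairs (ph X) n.+1; rewrite mulnS => ->. Qed.

Lemma S'E X k :
  S' X k%:R = cycsum (2 * n.+1) (fun l => ph X l / al X l) (fun=> 1) k.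
Proof.
rewrite mulnS; apply: eq_bigr => j _; rewrite mulr1; apply: eq_bigr => l _.
by rewrite /ph /al -natrD.
Qed.

Lemma SevenE X i :
  Seven X (2 * i)%:R
  = cycsum n.+1 (fun m => al X (2 * m) / ph X (2 * m) * ph X (2 * m).+1)
                (fun m => 1 + al X (2 * m) / ph X (2 * m)) i.
Proof.
apply: eq_bigr => j _; rewrite -natrD -mulnDr; congr (_ * _).
by apply: eq_bigr => k _; rewrite -!natrD -mulnDr addnS -mulnDr.
Qed.

Lemma SoddE X i :
  Sodd X (2 * i).+1%:R
  = cycsum n.+1 (fun m => ph X (2 * m).+1 * (al X (2 * m).+2 / ph X (2 * m).+2))
                (fun m => 1 + ph X (2 * m).+1) i.
Proof.
apply: eq_bigr => j _; rewrite -natrD addSn -mulnDr; congr (_ * _).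
by apply: eq_bigr => k _; rewrite -!natrD !addSn addnS -mulnDr.
Qed.

Lemma ph_s1_even X i :
  ph (s1 X) (2 * i)
  = al X (2 * i) * ph X (2 * i).+1 * (Seven X (2 * i.+1)%:R / Seven X (2 * i)%:R).
Proof.
rewrite /ph /= odd_natr oddM /= natr1 -natrD.
by have -> : (2 * i.+1 = 2 * i + 2)%N by rewrite mulnS addnC.
Qed.

Lemma ph_s1_odd X i :
  ph (s1 X) (2 * i).+1
  = ph X (2 * i).+2 / al X (2 * i).+2
    * (Sodd X (2 * i).+1%:R / Sodd X (2 * i.+1).+1%:R).
Proof.
rewrite /ph /= odd_natr /= oddM /= natr1 -natrD.
by have -> : ((2 * i.+1).+1 = (2 * i).+1 + 2)%N by rewrite mulnS addn2.
Qed.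

Lemma ph_s1' X k :
  ph (s1' X) k = al X k * al X k.+1 / ph X k.+1 * (S' X k%:R / S' X k.+2%:R).
Proof. by rewrite /ph /al /= natr1 -natrD addn2. Qed.

Lemma al_pi X k : al (pi_ X) k = al X k.+1.
Proof. by rewrite /al /= natr1. Qed.

Lemma ph_pi X k : ph (pi_ X) k = ph X k.+1.
Proof. by rewrite /ph /= natr1. Qed.

Lemma al_pi_inv_pi' X k : al (Defs.pi_inv (pi_' X)) k = al X k.
Proof. by rewrite /al /= subrK. Qed.

Lemma ph_pi_inv_pi' X k : ph (Defs.pi_inv (pi_' X)) k = al X k / ph X k.
Proof. by rewrite /ph /= subrK. Qed.

End NatIndices.

Section Images.
Variables (n : nat) (F L : fieldType) (h : {rmorphism F -> L}).
Implicit Types (X : apoint n F).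

(** The main result applies [iota] after a transformation, while the computations are made on the
    image point; record equality allows [iota] to be moved inside by rewriting. *)
Lemma apoint_eq n' (K : Type) (X Y : apoint n' K) :
  alpha X =1 alpha Y -> phi X =1 phi Y -> X = Y.
Proof.
case: X Y => [a p] [a' p'] /= ea ep.
by rewrite (functional_extensionality _ _ ea) (functional_extensionality _ _ ep).
Qed.

Lemma apoint_map_r X j : apoint_map h (r j X) = r j (apoint_map h X).
Proof.
apply: apoint_eq => i /=.
  by do 2?case: ifP => _; rewrite ?fmorphV ?rmorphM.
by rewrite !rmorphM !fmorphXz fmorph_div !rmorphD rmorph1.
Qed.

Lemma map_Seven X m : h (Seven X m) = Seven (apoint_map h X) m.
Proof.
rewrite rmorph_sum; apply: eq_bigr => j _.
rewrite rmorphM rmorphD rmorph1 fmorph_div rmorph_prod; congr (_ * _).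
by apply: eq_bigr => k _; rewrite rmorphM fmorph_div.
Qed.

Lemma map_Sodd X m : h (Sodd X m) = Sodd (apoint_map h X) m.
Proof.
rewrite rmorph_sum; apply: eq_bigr => j _.
rewrite rmorphM rmorphD rmorph1 rmorph_prod; congr (_ * _).
by apply: eq_bigr => k _; rewrite rmorphM fmorph_div.
Qed.

Lemma map_S' X m : h (S' X m) = S' (apoint_map h X) m.
Proof.
rewrite rmorph_sum; apply: eq_bigr => j _.
by rewrite rmorph_prod; apply: eq_bigr => k _; rewrite fmorph_div.
Qed.

Lemma apoint_map_s1 X : apoint_map h (s1 X) = s1 (apoint_map h X).
Proof.
apply: apoint_eq => i //=; rewrite -!map_Seven -!map_Sodd.
by case: ifP => _; rewrite !rmorphM !fmorphV.
Qed.

Lemma apoint_map_s1' X : apoint_map h (s1' X) = s1' (apoint_map h X).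
Proof.
by apply: apoint_eq => i //=; rewrite -!map_S' !rmorphM !fmorphV.
Qed.

Lemma apoint_map_tau1 X : apoint_map h (tau1 X) = tau1 (apoint_map h X).
Proof.
rewrite /tau1 apoint_map_s1 apoint_map_s1'; congr (s1 (s1' _)).
by apply: apoint_eq => i //=; rewrite fmorph_div.
Qed.

End Images.

(* Expressions without subtraction in the alpha_i and phi_i: on independent
   variables they do not vanish, since they are positive where all variables
   are 1. *)
Inductive subfree n (F : fieldType) (X : apoint n F) : F -> Prop :=
| subfree_alpha i : subfree X (alpha X i)
| subfree_phi i : subfree X (phi X i)
| subfree_1 : subfree X 1
| subfree_add x y : subfree X x -> subfree X y -> subfree X (x + y)
| subfree_mul x y : subfree X x -> subfree X y -> subfree X (x * y)
| subfree_inv x : subfree X x -> subfree X x^-1.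

Definition generic n (F : fieldType) (X : apoint n F) : Prop :=
  forall x, subfree X x -> x != 0.

Lemma subfree_prod n (F : fieldType) (X : apoint n F) (I : Type) (s : seq I) P (f : I
  -> F) :
  (forall i, subfree X (f i)) -> subfree X (\prod_(i <- s | P i) f i).
Proof. by move=> hf; elim/big_ind: _ => //; constructor. Qed.

Lemma subfree_cycsum n (F : fieldType) (X : apoint n F) M (c d : nat -> F) i :
  (forall k, subfree X (c k)) -> (forall k, subfree X (d k)) ->
  subfree X (cycsum M.+1 c d i).
Proof.
move=> hc hd; rewrite /cycsum; elim: M => [|M IH].
  by rewrite big_ord_recl big_ord0 addr0; constructor=> //; apply: subfree_prod.
rewrite big_ord_recr /=; apply: subfree_add => //.
by constructor=> //; apply: subfree_prod.
Qed.

(** Transfers genericity to the field containing the roots: a subtraction-free expression in the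
    images is the image of one, and field morphisms are injective. *)
Lemma generic_map n (F L : fieldType) (h : {rmorphism F -> L}) (X : apoint n F) :
  generic X -> generic (apoint_map h X).
Proof.
move=> gX x hx; suff [y hy ->] : exists2 y, subfree X y & x = h y.
  by rewrite fmorph_eq0 gX.
elim: hx => [i|i||_ _ _ [x1 h1 ->] _ [y1 h2 ->]|_ _ _ [x1 h1 ->] _ [y1 h2 ->]|_ _ [x1
  h1 ->]].
- by exists (alpha X i) => //; constructor.
- by exists (phi X i) => //; constructor.
- by exists 1; rewrite ?rmorph1; constructor.
- by exists (x1 + y1); rewrite ?rmorphD; constructor.
- by exists (x1 * y1); rewrite ?rmorphM; constructor.
- by exists x1^-1; rewrite ?fmorphV; constructor.
Qed.

Lemma generic_generators n : generic (generators n).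
Proof.
pose ev (p : {mpoly rat[(2 * n).+2 + (2 * n).+2]}) := p.@[fun=> 1].
have ev_nz p : (0 < ev p)%R -> tofrac p != 0 :> QAlphaPhi n.
  by rewrite tofrac_eq0; apply: contraTneq => ->; rewrite /ev meval0
    Order.POrderTheory.ltxx.
move=> x hx.
(* Evaluation at 1 is not defined on the whole fraction field, so numerator and denominator are
   tracked separately; inversion swaps them. *)
suff [p [r [hp hr ->]]] : exists p r, [/\ (0 < ev p)%R, (0 < ev r)%R
    & x = tofrac p / tofrac r].
  by rewrite mulf_neq0 ?invr_neq0 ?ev_nz.
elim: hx => [i|i||_ _ _ [p1 [r1 [h1 k1 ->]]] _ [p2 [r2 [h2 k2 ->]]]
  |_ _ _ [p1 [r1 [h1 k1 ->]]] _ [p2 [r2 [h2 k2 ->]]]|_ _ [p [r [h1 k1 ->]]]].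
- by exists 'X_(lshift _ i), 1; rewrite /ev mevalXU meval1 tofrac1 divr1.
- by exists 'X_(rshift _ i), 1; rewrite /ev mevalXU meval1 tofrac1 divr1.
- by exists 1, 1; rewrite /ev meval1 tofrac1 divr1.
- exists (p1 * r2 + p2 * r1), (r1 * r2); rewrite /ev mevalD !mevalM.
  rewrite Num.Theory.addr_gt0 ?Num.Theory.mulr_gt0 //; split=> //.
  by rewrite tofracD !tofracM addf_div ?ev_nz.
- exists (p1 * p2), (r1 * r2); rewrite /ev !mevalM !Num.Theory.mulr_gt0 //; split=> //.
  by rewrite !tofracM mulf_div.
- by exists r, p; rewrite invf_div.
Qed.

(** * The identification in terms of neighbouring indices *)

Lemma subfree_exp n (F : fieldType) (X : apoint n F) x k :
  subfree X x -> subfree X (x ^+ k).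
Proof. by move=> hx; elim: k => [|k IH]; rewrite ?exprS ?expr0; constructor. Qed.

Lemma subfree_al n (F : fieldType) (X : apoint n F) k : subfree X (al X k).
Proof. exact: subfree_alpha. Qed.

Lemma subfree_ph n (F : fieldType) (X : apoint n F) k : subfree X (ph X k).
Proof. exact: subfree_phi. Qed.

Lemma generic_trans n (F : fieldType) (X X' : apoint n F) :
  (forall i, subfree X (alpha X' i)) -> (forall i, subfree X (phi X' i)) ->
  generic X -> generic X'.
Proof.
move=> ha hp gX x hx; apply: gX; elim: hx => //; by constructor.
Qed.

Ltac subfree_tac :=
  repeat first
    [ assumption
    | apply: subfree_al | apply: subfree_ph | apply: subfree_1
    | apply: subfree_add | apply: subfree_mul | apply: subfree_inv
    | apply: subfree_exp
    | apply: subfree_cycsum => ? ].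

Ltac nonzero gX :=
  repeat (apply/andP; split);
  repeat first
    [ assumption | solve [apply: gX; subfree_tac]
    | rewrite oppr_eq0 | apply: mulf_neq0 | apply: invr_neq0 | apply: expf_neq0 ].

Section LocalRelations.
Variables (n : nat) (F : fieldType) (q qhalf : F).
Hypothesis q_sqr : qhalf ^+ 2 = q.
Implicit Types (X : apoint n F) (Y : qpoint F) (i j k : nat).

(* f_0, ..., f_n together with f_(n+1) = 1, the value that continues the
   relation between f_i and f_(i+1) below to i = n. *)
Definition fext Y i : F := if i == n.+1 then 1 else f_ Y i.

(** The boundary cases close the cycle: at i = n the relation for f uses f_(n+1) = 1 and phi_(2n+2)
    = phi_0, and at i = 0 the relations use b_0 = q b_(n+1) and g_0. The product formulas for q, t
    and beta_0 become consequences. *)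
Definition matched X Y : Prop :=
  [/\ forall i, (i <= n)%N -> qa Y i.+1 != 0,
      forall i, (i <= n)%N -> b_ n q Y i = qa Y i.+1 * al X (2 * i),
      forall i, (i <= n)%N -> qa Y i.+1 = al X (2 * i).+1 * qb Y i.+1,
      forall i, (i <= n)%N ->
        fext Y i * (1 + ph X (2 * i).+2)
        = fext Y i.+1
          * ((1 + ph X (2 * i)) * ph X (2 * i).+1 * ph X (2 * i).+2)
    & forall i, (i <= n)%N -> g_ n qhalf Y i = - b_ n q Y i / ph X (2 * i)].

Definition rho_ok Y : Prop :=
  qrho Y ^+ n.+1 = q ^+ n * \prod_(1 <= i < n.+2) (qa Y i * qb Y i).

Definition ph_tail X i : F :=
  \prod_(i <= j < n.+1) (ph X (2 * j).+1 * ph X (2 * j).+2).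

Lemma ph_tail_rec X i : (i <= n)%N ->
  ph_tail X i = ph X (2 * i).+1 * ph X (2 * i).+2 * ph_tail X i.+1.
Proof. by move=> lein; rewrite /ph_tail big_ltn. Qed.

Lemma ph_tail_last X : ph_tail X n.+1 = 1.
Proof. by rewrite /ph_tail big_geq. Qed.

Lemma ph_2n2 X : ph X (2 * n).+2 = ph X 0.
Proof. exact: (ph_period X 0). Qed.

Lemma ph_tail0 X : ph_tail X 0 = beta0' X.
Proof.
rewrite beta0'E; transitivity (\prod_(k < (2 * n).+2) ph X k.+1); last first.
  by rewrite [RHS]big_ord_recl [LHS]big_ord_recr /= mulrC ph_2n2.
have := prod_pairs (fun k => ph X k.+1) n.+1; rewrite mulnS => ->.
by rewrite /ph_tail big_mkord.
Qed.

(** Descending induction from the value 1 at n+1. The closed form at i = 0 is t = beta'_0. *)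
Lemma fext_closed X Y : generic X ->
  (forall i, (i <= n)%N ->
     fext Y i * (1 + ph X (2 * i).+2)
     = fext Y i.+1 * ((1 + ph X (2 * i)) * ph X (2 * i).+1 * ph X (2 * i).+2))
  <-> (forall i, (i <= n.+1)%N ->
        fext Y i = (1 + ph X (2 * i)) / (1 + ph X 0) * ph_tail X i).
Proof.
move=> gX; split=> [rel i|E i lein]; last first.
  rewrite !E ?(leqW lein) // [in LHS]ph_tail_rec // mulnS.
  by field; nonzero gX.
move=> lein; rewrite -(subKn lein); elim: (n.+1 - i)%N => [|k IH].
  by rewrite subn0 ph_tail_last mulnS ph_2n2 divff ?mulr1 /fext ?eqxx //; nonzero gX.
(* Truncated subtraction: once [k] reaches n+1 both indices are 0 and the induction hypothesis is
   already the goal. *)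
case: (ltnP k n.+1) => ltkn; last by move: IH; have [-> ->]: (n.+1 - k.+1 = 0 /\ n.+1
  - k = 0)%N by lia.
set m := (n.+1 - k.+1)%N; have Em : (n.+1 - k = m.+1)%N by rewrite /m; lia.
have lemn : (m <= n)%N by rewrite /m; lia.
move: IH; rewrite Em mulnS => IH; rewrite ph_tail_rec //.
have nz : 1 + ph X (2 * m).+2 != 0 by nonzero gX.
apply: (mulIf nz); rewrite rel // IH.
by field; nonzero gX.
Qed.

Lemma b_S Y i : b_ n q Y i.+1 = qb Y i.+1. Proof. by []. Qed.

Lemma prod_b Y : \prod_(i < n.+1) b_ n q Y i = q * \prod_(i < n.+1) qb Y i.+1.
Proof.
rewrite big_ord_recl /= [in RHS]big_ord_recr /= /b_ eqxx -mulrA; congr (_ * _).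
by rewrite mulrC; congr (_ * _); apply: eq_bigr.
Qed.

(** Multiplied around the cycle, the relations between the a's and b's cancel except for the q in
    b_0 = q b_(n+1). *)
Lemma matched_qprod X Y : generic X -> matched X Y -> q = qprod X.
Proof.
move=> gX [a0 bE aE _ _].
have E : (\prod_(i < n.+1) b_ n q Y i) * \prod_(i < n.+1) qa Y i.+1
   = (\prod_(i < n.+1) qa Y i.+1) * (\prod_(i < n.+1) qb Y i.+1) * qprod X.
  rewrite qprod_pairs -!big_split /=; apply: eq_bigr => i _.
  have lein : (i <= n)%N by rewrite -ltnS.
  by rewrite (bE _ lein) (aE _ lein); ring.
have nza : \prod_(i < n.+1) qa Y i.+1 != 0.
  by apply/prodf_neq0 => i _; apply: a0; rewrite -ltnS.
have nzb : \prod_(i < n.+1) qb Y i.+1 != 0.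
  apply/prodf_neq0 => i _; have lein : (i <= n)%N by rewrite -ltnS.
  by have := a0 i lein; rewrite (aE _ lein) mulf_eq0 negb_or => /andP[].
apply: (mulIf (mulf_neq0 nza nzb)); move: E; rewrite prod_b => E.
by rewrite [RHS]mulrC -E; ring.
Qed.

Lemma subfree_qprod X : subfree X (qprod X).
Proof. by apply: subfree_prod => i; constructor. Qed.

Lemma matched_qb X Y i : matched X Y -> (i <= n)%N -> qb Y i.+1 != 0.
Proof.
move=> [a0 _ aE _ _] lein.
by have := a0 i lein; rewrite (aE _ lein) mulf_eq0 negb_or => /andP[].
Qed.

Lemma matched_b X Y i : generic X -> matched X Y -> (i <= n)%N ->
  b_ n q Y i != 0.
Proof.
by move=> gX [a0 bE _ _ _] lein; rewrite bE // mulf_neq0 ?a0 //; nonzero gX.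
Qed.

Lemma matched_qt X Y : generic X -> matched X Y -> qt Y = beta0' X.
Proof.
move=> gX [_ _ _ /(fext_closed Y gX) E _].
have := E 0 isT; rewrite /fext /f_ /= => ->.
by rewrite ph_tail0 divff ?mul1r //; nonzero gX.
Qed.

Lemma q_neq0 X Y : generic X -> matched X Y -> q != 0.
Proof.
by move=> gX mXY; rewrite (matched_qprod gX mXY) gX //; apply: subfree_qprod.
Qed.

(** The definition of g_0 says that the product of all g_i, times this prefactor, is 1; substituting
    g_i = -b_i/phi_(2i) leaves only the signs. *)
Lemma prod_g X Y : generic X -> matched X Y ->
  qhalf ^ (n%:Z - 2) * qt Y * \prod_(i < n.+1) (b_ n q Y i / ph X (2 * i))
  = (-1) ^+ n.+1.
Proof.
move=> gX mXY; have [_ _ _ _ gE] := mXY.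
have nzg i : (i <= n)%N -> g_ n qhalf Y i != 0.
  move=> lein; rewrite gE // mulNr oppr_eq0 mulf_neq0 ?(matched_b gX mXY) //.
  by nonzero gX.
have -> : \prod_(i < n.+1) (b_ n q Y i / ph X (2 * i))
    = (-1) ^+ n.+1 * \prod_(i < n.+1) g_ n qhalf Y i.
  have -> : (-1) ^+ n.+1 = \prod_(i < n.+1) (-1 : F) by rewrite prodr_const card_ord.
  rewrite -big_split /=.
  apply: eq_bigr => i _; have lein : (i <= n)%N by rewrite -ltnS.
  by rewrite (gE _ lein); ring.
rewrite big_ord_recl /= {1}/g_ /=.
have -> : \prod_(i < n) g_ n qhalf Y (lift ord0 i) = \prod_(1 <= k < n.+1) qg Y k.
  by rewrite big_add1 /= big_mkord.
have : g_ n qhalf Y 0 != 0 by apply: nzg.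
rewrite /g_ /= invr_eq0 => nz.
by move: nz; rewrite !mulf_eq0 !negb_or => /andP[/andP[n1 n2] n3]; field; rewrite n1
  n2 n3.
Qed.

Lemma qhalf_sqr : q != 0 -> (qhalf ^ (n%:Z - 2)) ^+ 2 = q ^+ n / q ^+ 2.
Proof.
move=> q0; have qh0 : qhalf != 0 by move: q0; rewrite -q_sqr expf_eq0.
rewrite expfzDr // -exprnP exprMn -q_sqr -!exprM mulnC; congr (_ * _).
by rewrite -exprnN -exprVn -exprM exprVn.
Qed.

(** Converse of [prod_g]: the relation for g_0, with the right sign, follows from those for g_1,
    ..., g_n and one product formula. It serves the transformations that change g_1, ..., g_n, whose
    rules do not list g_0. *)
Lemma g0_prod X Y :
  b_ n q Y 0 / ph X 0 != 0 ->
  (forall i, (1 <= i <= n)%N -> qg Y i = - b_ n q Y i / ph X (2 * i)) ->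
  qhalf ^ (n%:Z - 2) * qt Y * \prod_(i < n.+1) (b_ n q Y i / ph X (2 * i))
  = (-1) ^+ n.+1 ->
  g_ n qhalf Y 0 = - b_ n q Y 0 / ph X 0.
Proof.
move=> nz gE; rewrite big_ord_recl muln0 /g_ /= big_add1 /= big_mkord => E.
rewrite (eq_bigr (fun i : 'I_n => -1 * (b_ n q Y i.+1 / ph X (2 * i.+1)))); last first.
  by move=> i _; rewrite gE // ?ltn_ord //; ring.
rewrite big_split /= prodr_const card_ord; apply: invr_inj; rewrite invrK.
move: E; move: (qhalf ^ _) (\prod_(i < n) _) => s p E.
apply: (mulIf nz); rewrite mulNr invrN mulNr mulVf //.
transitivity ((-1) ^+ n * (s * qt Y * (b_ n q Y 0 / ph X 0 * p))); first by ring.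
by rewrite E exprSr mulrA -expr2 sqrr_sign mul1r.
Qed.

Lemma matched_identified X Y :
  generic X -> matched X Y -> rho_ok Y -> identified q qhalf X Y.
Proof.
move=> gX mXY rhoY; have [a0 bE aE fE gE] := mXY.
have b0 i := matched_qb mXY (i := i); have q0 := q_neq0 gX mXY.
have tE := matched_qt gX mXY.
have t0 : qt Y != 0.
  by rewrite tE beta0'E gX //; apply: subfree_prod => i; subfree_tac.
split.
- split.
  + exact: matched_qprod mXY.
  + by case=> [|i] lein //; rewrite (aE _ lein) mulfK ?b0 // mulnS.
  + case=> [|i] lein //; rewrite -[qb Y _]/(b_ n q Y i.+1) bE // mulrC mulKf ?a0 //.
- split=> //.
  apply: (mulIf t0); rewrite {3}tE.
  (* Multiplying by beta'_0 removes the odd phi from beta_0 and leaves the even ones squared.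
     Squaring [prod_g] then kills the sign and turns the half-integer power of q into q^(n-2). *)
  have -> : beta0 X * beta0' X
      = (\prod_(i < n.+1) ph X (2 * i)) ^+ 2 * \prod_(i < n.+1) al X (2 * i).+1.
    rewrite -prodrXl -!big_split /=; apply: eq_bigr => i _.
    rewrite -/(ph X _) -/(ph X _) -/(al X _).
    by field; nonzero gX.
  have /(congr1 (fun x => x ^+ 2)) := prod_g gX mXY.
  rewrite -exprM mulnC exprM sqrrN expr1n expr1n prodf_div !exprMn exprVn => E.
  have nzP : \prod_(i < n.+1) ph X (2 * i) != 0.
    by rewrite gX //; apply: subfree_prod => i; subfree_tac.
  have -> : (\prod_(i < n.+1) ph X (2 * i)) ^+ 2
      = (qhalf ^ (n%:Z - 2)) ^+ 2 * qt Y ^+ 2 * (\prod_(i < n.+1) b_ n q Y i) ^+ 2.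
    move: E nzP; move: (qhalf ^ _) (\prod_i ph X _) => s p E p0.
    by rewrite -[LHS]mulr1 -[1 in LHS]E; field.
  rewrite qhalf_sqr //.
  rewrite prod_b big_add1 /= big_mkord big_split /=.
  have -> : \prod_(i < n.+1) qa Y i.+1
      = \prod_(i < n.+1) al X (2 * i).+1 * \prod_(i < n.+1) qb Y i.+1.
    rewrite -big_split /=; apply: eq_bigr => i _; have lein : (i <= n)%N by rewrite
      -ltnS.
    exact: aE.
  by field.
- move=> i /andP[i0 lein]; have /(fext_closed Y gX) E := fE.
  have := E i (leqW lein); rewrite /fext /f_ eqn_leq ltnNge lein andbF.
  by rewrite eqn0Ngt i0 /= => ->.
- case=> [|i] lein //; have := gE _ lein; rewrite -[g_ _ _ _ _]/(qg Y i.+1) => ->.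
  rewrite -[qb Y _]/(b_ n q Y i.+1) -/(ph X _).
  by field; rewrite (matched_b gX mXY) // andbT; nonzero gX.
- rewrite gE // -/(ph X 0) muln0.
  by field; rewrite (matched_b gX mXY) // andbT; nonzero gX.
Qed.

Lemma identified_rho X Y : identified q qhalf X Y -> rho_ok Y.
Proof. by case=> _ []. Qed.

Lemma identified_matched X Y :
  generic X -> identified q qhalf X Y -> matched X Y.
Proof.
move=> gX [[qE aE bE] [_ tE _] fE gE g0E].
have nzab i : (i <= n)%N -> (qa Y i.+1 != 0) && (qb Y i.+1 != 0).
  move=> lein; have E := aE i.+1 lein.
  have : qa Y i.+1 / qb Y i.+1 != 0 by rewrite E gX //; constructor.
  by rewrite mulf_eq0 invr_eq0 negb_or.
have a0 i (lein : (i <= n)%N) : qa Y i.+1 != 0 by case/andP: (nzab i lein).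
have b0 i (lein : (i <= n)%N) : qb Y i.+1 != 0 by case/andP: (nzab i lein).
have aE' i : (i <= n)%N -> qa Y i.+1 = al X (2 * i).+1 * qb Y i.+1.
  by move=> lein; have := aE i.+1 lein; rewrite mulnS /= -/(al X _) => <-; rewrite
    divfK ?b0.
have bE' i : (i < n)%N -> qb Y i.+1 = qa Y i.+2 * al X (2 * i.+1).
  by move=> ltin; have := bE i.+1 ltin; rewrite -/(al X _) => <-; rewrite mulrC divfK
    ?a0.
have q0 : q != 0 by rewrite qE gX //; apply: subfree_qprod.
(* This relation is not among the hypotheses; it is what remains of q = product of all alpha_i after
   division by the other 2n+1 relations. *)
have b0E : q * qb Y n.+1 = qa Y 1 * al X 0.
  have E : (\prod_(i < n.+1) qa Y i.+1) * \prod_(i < n) qb Y i.+1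
     = ((\prod_(i < n.+1) qb Y i.+1) * \prod_(i < n) qa Y i.+2) * (q / al X 0).
    rewrite qE qprod_pairs big_split /= [\prod_(i < n.+1) al X (2 * i)]big_ord_recl.
    rewrite (eq_bigr (fun i : 'I_n.+1 => al X (2 * i).+1 * qb Y i.+1)); last first.
      by move=> i _; apply: aE'; rewrite -ltnS.
    rewrite [\prod_(i < n) qb _ _](eq_bigr (fun i : 'I_n => qa Y i.+2 * al X (2 *
      i.+1))); last first.
      by move=> i _; apply: bE'.
    rewrite !big_split /=.
    by field; nonzero gX.
  move: E; rewrite big_ord_recl [\prod_(i < n.+1) qb _ _]big_ord_recr /= => E.
  have nz : (\prod_(i < n) qb Y i.+1) * \prod_(i < n) qa Y i.+2 != 0.
    rewrite mulf_neq0 //; apply/prodf_neq0 => i _; last exact: a0.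
    by rewrite b0 // ltnW.
  have al0 : al X 0 != 0 by nonzero gX.
  apply: (mulIf nz); apply: (mulIf (invr_neq0 al0)).
  transitivity ((\prod_(i < n) qb Y i.+1 * qb Y n.+1 * \prod_(i < n) qa Y i.+2) * (q
    / al X 0)).
    by ring.
  by rewrite -E; rewrite (eq_bigr (fun i : 'I_n => qa Y i.+2)) //; field.
have b0' i : (i <= n)%N -> b_ n q Y i != 0.
  by case: i => [|i] lein; rewrite /b_ /= ?mulf_neq0 ?b0 // ltnW.
split=> //.
- by case=> [|i] lein //; rewrite b_S bE'.
- apply/(fext_closed Y gX) => i lein; rewrite /fext /f_; case: eqP => [->|/eqP neq].
    by rewrite ph_tail_last mulnS ph_2n2 divff ?mulr1 //; nonzero gX.
  case: i lein neq => [|i] lein neq.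
    by rewrite /= ph_tail0 divff ?mul1r //; nonzero gX.
  by rewrite /= fE //; move: lein neq; lia.
- case=> [|i] lein.
    have := g0E; rewrite -/(ph X 0) => /(congr1 (fun x => x * b_ n q Y 0)).
    by rewrite divfK ?b0' // => ->; rewrite muln0; ring.
  have := gE i.+1 lein; rewrite -/(ph X _) => /(congr1 (fun x => x * qb Y i.+1)).
  by rewrite divfK ?b0 ?(ltnW lein) // => E; rewrite -[LHS]/(qg Y i.+1) E b_S; ring.
Qed.

End LocalRelations.

Section S'Sums.
Variables (n : nat) (F : fieldType).
Implicit Types (X : apoint n F) (k : nat).

Lemma prod_al_shift X k : \prod_(l < (2 * n).+2) al X (k + l) = qprod X.
Proof. by rewrite qprodE prod_periodic //; apply: al_period. Qed.

Lemma prod_ph_shift X k : \prod_(l < (2 * n).+2) ph X (k + l) = beta0' X.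
Proof. by rewrite beta0'E prod_periodic //; apply: ph_period. Qed.

(** The end correction is the product of phi/alpha over a full period, hence the same for every
    [k]. *)
Lemma S'_rec X k :
  S' X k%:R - ph X k / al X k * S' X k.+1%:R = 1 - beta0' X / qprod X.
Proof.
rewrite !S'E cycsum_rec mulr1; congr (_ - _).
by rewrite mulnS prodf_div prod_al_shift prod_ph_shift.
Qed.

Lemma subfree_S' X k : subfree X (S' X k%:R).
Proof. by rewrite S'E mulnS; subfree_tac. Qed.

Lemma S'_pi X k : S' (pi_ X) k%:R = S' X k.+1%:R.
Proof.
rewrite !S'E; apply: eq_bigr => j _; congr (_ * _); apply: eq_bigr => l _.
by rewrite al_pi ph_pi addSn.
Qed.

Lemma ph_s1'pi X k :
  ph (s1' (pi_ X)) k
  = al X k.+1 * al X k.+2 / ph X k.+2 * (S' X k.+1%:R / S' X k.+3%:R).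
Proof. by rewrite ph_s1' !al_pi !ph_pi !S'_pi. Qed.

Lemma al_s1'pi X k : al (s1' (pi_ X)) k = al X k.+1.
Proof. exact: al_pi. Qed.

Lemma generic_s1'pi X : generic X -> generic (s1' (pi_ X)).
Proof.
apply: generic_trans => i.
  by rewrite -[i]natr_Zp -/(al (s1' (pi_ X)) _) al_s1'pi; subfree_tac.
rewrite -[i]natr_Zp -/(ph (s1' (pi_ X)) _) ph_s1'pi.
by repeat apply: subfree_mul; try apply: subfree_inv; subfree_tac; apply: subfree_S'.
Qed.

End S'Sums.

Section ClosedForms.
Variables (n : nat) (F : fieldType) (q qhalf : F).
Hypothesis q_sqr : qhalf ^+ 2 = q.
Variables (X : apoint n F) (Y : qpoint F).
Hypotheses (gX : generic X) (mXY : matched q qhalf X Y).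
Implicit Types (i j k : nat).

(* Extensions of a_(i+1), b_i, g_i, f_i (0 <= i <= n) to all i, quasi-periodic
   with period n+1. *)
Definition acl i : F := qa Y 1 / \prod_(k < 2 * i) al X k.+1.
Definition bcl i : F := acl i * al X (2 * i).
Definition gcl i : F := - bcl i / ph X (2 * i).
Definition fcl i : F :=
  (1 + ph X (2 * i)) / (1 + ph X 0) * (qt Y / \prod_(k < 2 * i) ph X k.+1).

Lemma prod_al_neq0 m : \prod_(k < m) al X k.+1 != 0.
Proof. by apply: gX; apply: subfree_prod => k; subfree_tac. Qed.

Lemma prod_ph_neq0 m : \prod_(k < m) ph X k.+1 != 0.
Proof. by apply: gX; apply: subfree_prod => k; subfree_tac. Qed.

Lemma aclE i : acl i = al X (2 * i).+1 * bcl i.+1.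
Proof.
rewrite /bcl /acl mulnS !big_ord_recr /=; have nz := prod_al_neq0 (2 * i).
by field; nonzero gX.
Qed.

Lemma fcl_rec i :
  fcl i * (1 + ph X (2 * i).+2)
  = fcl i.+1 * ((1 + ph X (2 * i)) * ph X (2 * i).+1 * ph X (2 * i).+2).
Proof.
rewrite /fcl mulnS !big_ord_recr /=; have nz := prod_ph_neq0 (2 * i).
by field; nonzero gX.
Qed.

Lemma b_cl i : (i <= n)%N -> qa Y i.+1 = acl i -> b_ n q Y i = bcl i.
Proof. by move=> lein E; have [_ bE _ _ _] := mXY; rewrite bE // E. Qed.

Lemma a_cl i : (i <= n)%N -> qa Y i.+1 = acl i.
Proof.
have [a0 bE aE _ _] := mXY.
elim: i => [|i IH] lein; first by rewrite /acl muln0 big_ord0 divr1.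
have al0 k : al X k != 0 by nonzero gX.
have := IH (ltnW lein); rewrite (aE _ (ltnW lein)) -[qb _ _]/(b_ n q Y i.+1) bE //.
by rewrite aclE => /(mulfI (al0 _)) /(mulIf (al0 _)).
Qed.

Lemma b_cl' i : (i <= n)%N -> b_ n q Y i = bcl i.
Proof. by move=> lein; rewrite b_cl ?a_cl. Qed.

Lemma qb_cl i : (i <= n)%N -> qb Y i.+1 = bcl i.+1.
Proof.
move=> lein; have [a0 bE aE _ _] := mXY; have := a_cl lein.
rewrite aE // aclE => /mulfI; apply; by nonzero gX.
Qed.

Lemma g_cl i : (i <= n)%N -> g_ n qhalf Y i = gcl i.
Proof. by move=> lein; have [_ _ _ _ gE] := mXY; rewrite gE // b_cl'. Qed.

Lemma f_cl i : (i <= n)%N -> f_ Y i = fcl i.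
Proof.
have [_ _ _ fE _] := mXY.
elim: i => [|i IH] lein.
  by rewrite /fcl muln0 big_ord0 divff ?mul1r ?divr1 //; nonzero gX.
have fext_le j : (j <= n)%N -> fext n Y j = f_ Y j.
  by move=> lejn; rewrite /fext ifN // neq_ltn ltnS lejn.
have := fE i (ltnW lein); rewrite !fext_le ?(ltnW lein) // IH ?(ltnW lein) //.
by rewrite fcl_rec => /mulIf ->//; nonzero gX.
Qed.

Lemma q_prod : q = qprod X. Proof. exact: matched_qprod mXY. Qed.
Lemma t_prod : qt Y = beta0' X. Proof. exact: matched_qt mXY. Qed.

Lemma q0 : q != 0. Proof. exact: q_neq0 mXY. Qed.

Lemma t0 : qt Y != 0.
Proof. by rewrite t_prod beta0'E gX //; apply: subfree_prod => i; subfree_tac. Qed.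

Lemma acl0 i : acl i != 0.
Proof.
have [/(_ 0 isT) a0 _ _ _ _] := mXY.
by rewrite mulf_neq0 ?invr_neq0 ?prod_al_neq0.
Qed.

Lemma fcl0 i : fcl i != 0.
Proof.
by rewrite !mulf_neq0 ?invr_neq0 ?prod_ph_neq0 ?t0 //; nonzero gX.
Qed.

Lemma acl_period i : acl (i + n.+1) = acl i / q.
Proof.
rewrite /acl mulnDr mulnS big_split_ord /= -mulrA -invfM; congr (_ / (_ * _)).
by rewrite q_prod -(prod_al_shift X (2 * i).+1); apply: eq_bigr.
Qed.

Lemma bcl_period i : bcl (i + n.+1) = bcl i / q.
Proof. by rewrite /bcl acl_period al_even_period mulrAC. Qed.

Lemma gcl_period i : gcl (i + n.+1) = gcl i / q.
Proof. by rewrite /gcl bcl_period ph_even_period; ring. Qed.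

Lemma fcl_period i : fcl (i + n.+1) = fcl i / qt Y.
Proof.
rewrite /fcl ph_even_period mulnDr mulnS big_split_ord /= -!mulrA -invfM.
congr (_ * (_ * (_ / (_ * _)))).
by rewrite t_prod -(prod_ph_shift X (2 * i).+1); apply: eq_bigr.
Qed.

(** So the convention f_(n+1) = 1 in [fext] is exactly the quasi-periodicity f_(n+1) = f_0/t. *)
Lemma f_last : fcl n.+1 = 1.
Proof.
rewrite -[n.+1]add0n fcl_period /fcl muln0 big_ord0 divff ?mul1r ?divr1 ?divff ?t0 //.
by nonzero gX.
Qed.

End ClosedForms.

Local Arguments b_ : simpl never.
Local Arguments g_ : simpl never.
Local Arguments f_ : simpl never.

(** * The transformation s'_1 pi *)

Section PiTilde.
Variables (n : nat) (F : fieldType) (q qhalf qroot : F).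
Hypotheses (q_sqr : qhalf ^+ 2 = q) (q_root : qroot ^+ n.+1 = q).
Hypothesis n_gt0 : (0 < n)%N.
Variables (X : apoint n F) (Y : qpoint F).
Hypotheses (gX : generic X) (mXY : matched q qhalf X Y) (rhoY : rho_ok n q Y).
Implicit Types (i j k : nat).

Local Notation S k := (S' X k%:R).
Local Notation ac := (acl X Y).
Local Notation bc := (bcl X Y).
Local Notation gc := (gcl X Y).
Local Notation fc := (fcl X Y).
Local Notation A := (al X).
Local Notation P := (ph X).

Definition Rcl i : F := P (2 * i) / A (2 * i) * S (2 * i).+1.

Lemma Rcl_S i : Rcl i + 1 - qt Y / q = S (2 * i).
Proof.
by rewrite -addrA (t_prod gX mXY) (q_prod gX mXY) -(S'_rec X (2 * i)) addrC subrK.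
Qed.

Lemma S_neq0 k : S k != 0. Proof. by apply: gX; apply: subfree_S'. Qed.

Lemma S_period k : S (k + (2 * n).+2) = S k. Proof. by rewrite natr_period. Qed.

Lemma Rcl_period i : Rcl (i + n.+1) = Rcl i.
Proof.
by rewrite /Rcl al_even_period ph_even_period mulnDr mulnS -addSn S_period.
Qed.

Lemma bg_cl i : bc i - gc i = bc i * (1 + (P (2 * i))^-1).
Proof. by rewrite /gcl; field; nonzero gX. Qed.

(** The quantity w_j = (b_j - g_j)/f_j is a primitive of the paired ratios of S', whose full product
    is t/q. The sum in R*_i is thus w_i S'_(2i), except that its middle term carries t/q in place of
    1, which adds (t/q - 1) w_i. *)
Lemma Rstar_cl i : (i <= n)%N -> Rstar n q qhalf Y i = Rcl i.
Proof.
move=> lein; pose w j := (bc j - gc j) / fc j.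
have E j : (j <= n)%N ->
    (1 - qa Y j.+1 / g_ n qhalf Y j) * (b_ n q Y j - g_ n qhalf Y j) / f_ Y j
    = w j * (1 + P (2 * j) / A (2 * j)).
  move=> lejn; rewrite (a_cl gX mXY) // (b_cl' gX mXY) // (g_cl gX mXY) // (f_cl gX
    mXY) //.
  rewrite /w /gcl /bcl; have nz1 := acl0 gX mXY j; have nz2 := fcl0 gX mXY j.
  by field; nonzero gX.
rewrite /Rstar /=.
rewrite (eq_big_nat _ _ (F2 := fun j => qt Y / q * (w j * (1 + P (2 * j) / A (2 *
  j))))); last first.
  by move=> j /andP[_ ltji]; rewrite -E; [ring | lia].
rewrite [\sum_(i.+1 <= j < _) _](eq_big_nat _ _ (F2 := fun j => w j * (1 + P (2 * j)
  / A (2 * j)))); last first.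
  by move=> j /andP[_ ltji]; rewrite -E; [ring | lia].
have -> : (qt Y / q - qa Y i.+1 / g_ n qhalf Y i) * (b_ n q Y i - g_ n qhalf Y i) /
  f_ Y i
    = w i * (1 + P (2 * i) / A (2 * i)) + (qt Y / q - 1) * w i.
  rewrite -E // /w (b_cl' gX mXY) // (g_cl gX mXY) // (f_cl gX mXY) //.
  by ring.
have := @cycsum_unfold F n.+1 (fun m => P (2 * m) / A (2 * m) * (P (2 * m).+1 / A (2
  * m).+1))
  (fun m => 1 + P (2 * m) / A (2 * m)) w i (leqW lein).
rewrite -(cycsum_pair n.+1 (fun k => P k / A k)) -S'E.
have -> : \prod_(l < n.+1) (P (2 * l) / A (2 * l) * (P (2 * l).+1 / A (2 * l).+1)) =
  qt Y / q.
  rewrite (t_prod gX mXY) (q_prod gX mXY) qprodE beta0'E -prodf_div.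
  by rewrite -(prod_pairs (fun k => P k / A k)) mulnS.
rewrite /= big_ltn // -mulr_sumr => unf.
have wE : f_ Y i / (b_ n q Y i - g_ n qhalf Y i) = (w i)^-1.
  by rewrite /w invf_div (b_cl' gX mXY) // (g_cl gX mXY) // (f_cl gX mXY).
have w0 : w i != 0.
  rewrite /w bg_cl /bcl; have nz1 := acl0 gX mXY i; have nz2 := fcl0 gX mXY i.
  by nonzero gX.
rewrite wE; apply: (mulfI w0); rewrite mulVKf //.
have -> : Rcl i = S (2 * i) + (qt Y / q - 1) by rewrite -Rcl_S; ring.
rewrite [RHS]mulrDr unf; first by ring.
- by move=> k; rewrite !(al_even_period, ph_even_period, al_odd_period, ph_odd_period).
- by move=> k; rewrite !(al_even_period, ph_even_period).
- move=> k; rewrite /w !bg_cl /bcl (aclE Y gX k) /bcl.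
  have nz1 := fcl0 gX mXY k; have nz2 := fcl0 gX mXY k.+1.
  have nz : 1 + P (2 * k).+2 != 0 by nonzero gX.
  rewrite -[fc k](mulfK nz) fcl_rec // mulnS.
  by field; nonzero gX.
Qed.

(** The rule for the image of f_i with i < n, read for all i through the closed forms; by
    quasi-periodicity it also covers the separate rule for f_n. *)
Definition pi_f i : F :=
  qt (pit n q qhalf qroot Y)
  * (((gc i * Rcl i - bc i.+1 * Rcl i.+1) * (bc i.+1 - gc i.+1) * S (2 * i).+2 * fc 1)
     / ((gc 0 * Rcl 0 - bc 1 * Rcl 1) * (bc 1 - gc 1) * S 2 * fc i.+1)).

(** Write phi' for the transformed phi. The first product is -a_(i+1) S'_(2i+1) and the second is
    a_(i+1) S'_(2i+1)/phi'_(2i); this is where the factor 1 + phi'_(2i) of the new f_i comes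
    from. *)
Lemma pi_f_factor i :
  gc i * Rcl i - bc i.+1 * Rcl i.+1
  = - ac i * S (2 * i).+1 * (1 + (ph (s1' (pi_ X)) (2 * i))^-1).
Proof.
rewrite ph_s1'pi /gcl /Rcl /bcl (aclE Y gX i) /bcl mulnS.
have nz1 := S_neq0 (2 * i).+1; have nz3 := S_neq0 (2 * i).+3.
by field; nonzero gX.
Qed.

Lemma pi_fE : exists K, forall i,
  pi_f i = K * (ac i * bc i.+1 / fc i.+1 * (1 + (P (2 * i).+2)^-1)
                * S (2 * i).+1 * S (2 * i).+2
                * (1 + (ph (s1' (pi_ X)) (2 * i))^-1)).
Proof.
exists (- qt (pit n q qhalf qroot Y) * fc 1
   / ((gc 0 * Rcl 0 - bc 1 * Rcl 1) * (bc 1 - gc 1) * S 2)) => i.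
rewrite /pi_f pi_f_factor bg_cl mulnS [(_ * fc i.+1)^-1]invfM.
by ring.
Qed.

Lemma pi_f_rec i :
  pi_f i * (1 + ph (s1' (pi_ X)) (2 * i).+2)
  = pi_f i.+1
    * ((1 + ph (s1' (pi_ X)) (2 * i)) * ph (s1' (pi_ X)) (2 * i).+1
       * ph (s1' (pi_ X)) (2 * i).+2).
Proof.
have [K KE] := pi_fE; rewrite !KE mulnS.
have gX' := generic_s1'pi gX.
have p0 k : ph (s1' (pi_ X)) k != 0 by nonzero gX'.
(* Only the odd transformed phi is eliminated; the even ones remain atoms, since they also occur
   inside 1 + 1/phi'. *)
have E : ph (s1' (pi_ X)) (2 * i) * ph (s1' (pi_ X)) (2 * i).+1 * (S (2 * i).+3 * S
  (2 * i).+4)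
  = A (2 * i).+1 * A (2 * i).+2 ^+ 2 * A (2 * i).+3 / (P (2 * i).+2 * P (2 * i).+3)
    * (S (2 * i).+1 * S (2 * i).+2).
  rewrite !ph_s1'pi.
  have nz3 := S_neq0 (2 * i).+3; have nz4 := S_neq0 (2 * i).+4.
  by field; nonzero gX.
have fE := fcl_rec Y gX i.+1; rewrite mulnS in fE.
have nz : 1 + P (2 * i).+4 != 0 by nonzero gX.
have f0 := fcl0 gX mXY i.+2.
rewrite -[fc i.+1](mulfK nz) fE /bcl (aclE Y gX i) /bcl (aclE Y gX i.+1) /bcl !mulnS.
have nz1 := p0 (2 * i)%N; have nz2 := p0 (2 * i).+2.
have nz3 := S_neq0 (2 * i).+3; have nz4 := S_neq0 (2 * i).+4.
have -> : ph (s1' (pi_ X)) (2 * i).+1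
    = A (2 * i).+1 * A (2 * i).+2 ^+ 2 * A (2 * i).+3 / (P (2 * i).+2 * P (2 * i).+3)
      * (S (2 * i).+1 * S (2 * i).+2)
      / (ph (s1' (pi_ X)) (2 * i) * (S (2 * i).+3 * S (2 * i).+4)).
  by rewrite -E; field; nonzero gX.
by field; nonzero gX.
Qed.

Lemma pi_f_period i : pi_f (i + n.+1) = pi_f i / (qt (pit n q qhalf qroot Y)).
Proof.
have E1 : (gc (i + n.+1) * Rcl (i + n.+1) - bc (i + n.+1).+1 * Rcl (i + n.+1).+1)
   = (gc i * Rcl i - bc i.+1 * Rcl i.+1) / q.
  by rewrite -addSn !Rcl_period (gcl_period gX mXY) (bcl_period gX mXY); ring.
have q_neq0 := q0 gX mXY; have t_neq0 := t0 gX mXY.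
rewrite /pi_f E1 -addSn (gcl_period gX mXY) (bcl_period gX mXY) (fcl_period gX mXY).
have -> : S (2 * (i + n.+1)).+2 = S (2 * i).+2 by rewrite mulnDr mulnS -!addSn S_period.
rewrite [(_ * (fc i.+1 / _))^-1]invfM [(_ * fc i.+1)^-1]invfM.
move: (_ * S 2)^-1 => K; have f_neq0 := fcl0 gX mXY i.+1.
by rewrite /=; field; nonzero gX.
Qed.

(** The denominator in the rule is the numerator at i = 0. Together with [pi_f_period] this gives
    the required value 1 at n+1. *)
Lemma pi_f0 : pi_f 0 = qt (pit n q qhalf qroot Y).
Proof.
rewrite /pi_f divff ?mulr1 // pi_f_factor bg_cl /bcl.
have gX' := generic_s1'pi gX; have nz : 1 + (ph (s1' (pi_ X)) (2 * 0))^-1 != 0 by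
  nonzero gX'.
have nz0 := acl0 gX mXY 0; have nz1 := acl0 gX mXY 1; have nz2 := fcl0 gX mXY 1.
have nz3 := S_neq0 (2 * 0).+1; have nz4 := S_neq0 2.
by nonzero gX.
Qed.

Lemma pi_fext i : (i <= n.+1)%N -> fext n (pit n q qhalf qroot Y) i = pi_f i.
Proof.
have q_neq0 := q0 gX mXY; have t_neq0 := t0 gX mXY.
rewrite /fext; case: eqP => [-> _|/eqP neq lei].
  by rewrite -[n.+1]add0n pi_f_period pi_f0 divff // mulf_neq0 ?invr_neq0 ?expf_neq0.
case: i => [|i] in neq lei *; first by rewrite pi_f0.
have lein : (i.+1 <= n)%N by move: neq lei; lia.
have F1 : qf Y 1 = fc 1 by rewrite -[LHS]/(f_ Y 1) (f_cl gX mXY).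
have G1 : qg Y 1 = gc 1 by rewrite -(g_cl gX mXY n_gt0).
have B1 : qb Y 1 = bc 1 by rewrite (qb_cl gX mXY).
have den_eq : (g_ n qhalf Y 0 * Rstar n q qhalf Y 0 - b_ n q Y 1 * Rstar n q qhalf Y 1)
   * (b_ n q Y 1 - g_ n qhalf Y 1) * (Rstar n q qhalf Y 1 + 1 - qt Y / q)
   = (gc 0 * Rcl 0 - bc 1 * Rcl 1) * (bc 1 - gc 1) * S 2.
  by rewrite !Rstar_cl // !(g_cl gX mXY) // !(b_cl' gX mXY) // Rcl_S.
rewrite {1}/f_ [LHS]/= den_eq /pi_f.
rewrite (f_cl gX mXY n_gt0).
case: eqP => [Ei|/eqP ne].
  (* Here [i.+1] is n. The factor 1/q from b_(n+1) - g_(n+1) and the factor t from 1/f_(n+1) turn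
     q^2/t into the prefactor q of the separate rule. *)
  have -> : b_ n q Y n.+1 = bc i.+2 by rewrite Ei b_S (qb_cl gX mXY).
  have Rper : Rcl 0 = Rcl i.+2 by rewrite Ei -(Rcl_period 0).
  rewrite Ei !Rstar_cl // (g_cl gX mXY (leqnn n)) Rcl_S.
  have -> : S (2 * 0) = S (2 * n).+2 by rewrite muln0 -[in RHS](add0n (2 * n).+2)
    S_period.
  rewrite (b_cl' gX mXY) // (g_cl gX mXY) // (f_cl gX mXY (leq0n n)) Rper Ei.
  rewrite -[n.+1]add0n (bcl_period gX mXY) (gcl_period gX mXY) (fcl_period gX mXY) /=.
  rewrite [(_ * (fc 0 / _))^-1]invfM [(_ * fc 0)^-1]invfM.
  move: (_ * S 2)^-1 => K; have f_neq0 := fcl0 gX mXY 0.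
  by field; nonzero gX.
have ltin : (i.+2 <= n)%N by move: ne lein; lia.
by rewrite !Rstar_cl // !(g_cl gX mXY) // !(b_cl' gX mXY) // (f_cl gX mXY) // Rcl_S
  mulnS.
Qed.

Lemma prod_qab : \prod_(1 <= i < n.+2) (qa Y i * qb Y i)
  = (\prod_(i < n.+1) qa Y i.+1) * \prod_(i < n.+1) qb Y i.+1.
Proof. by rewrite big_add1 /= big_mkord big_split. Qed.

Lemma prod_qa_neq0 : \prod_(i < n.+1) qa Y i.+1 != 0.
Proof. by have [a0 _ _ _ _] := mXY; apply/prodf_neq0 => i _; rewrite a0 ?leq_ord. Qed.

Lemma prod_qb_neq0 : \prod_(i < n.+1) qb Y i.+1 != 0.
Proof. by apply/prodf_neq0 => i _; rewrite (matched_qb mXY) ?leq_ord. Qed.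

Lemma qrho_neq0 : qrho Y != 0.
Proof.
suff : qrho Y ^+ n.+1 != 0 by rewrite expf_eq0.
by rewrite rhoY prod_qab !mulf_neq0 ?expf_neq0 ?prod_qa_neq0 ?prod_qb_neq0 // (q0 gX
  mXY).
Qed.

Lemma b_pit i : (i <= n)%N -> b_ n q (pit n q qhalf qroot Y) i = qa Y i.+1 / qrho Y.
Proof.
have q_neq0 := q0 gX mXY; have p_neq0 := qrho_neq0.
case: i => [|i] lein; first by rewrite /b_ /= eqxx; field; nonzero gX.
by rewrite /b_ /= ifN // neq_ltn ltnS lein.
Qed.

Lemma qg_pit i : (0 < i <= n)%N ->
  qg (pit n q qhalf qroot Y) i
  = - b_ n q (pit n q qhalf qroot Y) i / ph (s1' (pi_ X)) (2 * i).
Proof.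
case: i => [//|i] lein; rewrite b_pit // (a_cl gX mXY) //.
have p_neq0 := qrho_neq0.
have -> : qg (pit n q qhalf qroot Y) i.+1
    = ac i.+1 / qrho Y * (bc i.+2 * Rcl i.+2 / (gc i.+1 * Rcl i.+1)).
  rewrite [LHS]/=; case: eqP => [Ei|/eqP ne].
    have -> : b_ n q Y n.+1 = bc i.+2 by rewrite Ei b_S (qb_cl gX mXY).
    have -> : qa Y n.+1 = ac i.+1 by rewrite -(a_cl gX mXY lein) Ei.
    have -> : Rcl i.+2 = Rcl 0 by rewrite Ei -(Rcl_period 0).
    have -> : Rcl i.+1 = Rstar n q qhalf Y n by rewrite -Rstar_cl // Ei.
    by rewrite Rstar_cl // (g_cl gX mXY (leqnn n)) Ei.
  have ltin : (i.+2 <= n)%N by move: ne lein; lia.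
  by rewrite (a_cl gX mXY) // (b_cl' gX mXY) // !Rstar_cl // (g_cl gX mXY).
rewrite ph_s1'pi /gcl /Rcl /bcl (aclE Y gX i.+1) /bcl !mulnS.
have nz1 := S_neq0 (2 * i).+3; have nz2 := S_neq0 (2 * i).+4.+1.
have nz3 := acl0 gX mXY i.+2.
by field; nonzero gX.
Qed.

(** The quotients of S' cancel around the cycle, and the alphas of both parities multiply to q. *)
Lemma prod_ph_s1'pi_even :
  \prod_(i < n.+1) ph (s1' (pi_ X)) (2 * i) = q / \prod_(i < n.+1) P (2 * i).
Proof.
pose h m := (S (2 * m).+1)^-1.
have h0 k : h k != 0 by rewrite invr_neq0 ?S_neq0.
rewrite (eq_bigr (fun i : 'I_n.+1 => A (2 * i).+1 * A (2 * i.+1) / P (2 * (1 + i)) *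
  (h i.+1 / h i))); last first.
  by move=> i _; rewrite ph_s1'pi /h invrK add1n !mulnS; ring.
rewrite big_split /=; have /= -> := telescope_ratio 0 n.+1 h0.
have -> : h n.+1 = h 0 by rewrite /h mulnS -(S_period 1).
rewrite divff // mulr1 prodf_div big_split /=; congr (_ / _); last first.
  by apply: (prod_periodic (c := fun m => P (2 * m))) => k; apply: ph_even_period.
rewrite (q_prod gX mXY) qprod_pairs big_split /= mulrC; congr (_ * _).
by apply: (prod_periodic (c := fun m => A (2 * m)) 1) => k; apply: al_even_period.
Qed.

Lemma pit_matched : matched q qhalf (s1' (pi_ X)) (pit n q qhalf qroot Y).
Proof.
have [a0 bE aE fE gE] := mXY.
have q_neq0 := q0 gX mXY; have p_neq0 := qrho_neq0; have t_neq0 := t0 gX mXY.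
split.
- by move=> i lein; rewrite /= mulf_neq0 ?invr_neq0 // b_S (matched_qb mXY).
- by move=> i lein; rewrite b_pit // al_s1'pi aE //= b_S; ring.
- move=> i lein; rewrite al_s1'pi /= b_S (qb_cl gX mXY) // /bcl mulnS; case: eqP =>
  [[->]|/eqP ne].
    have -> : ac n.+1 = qa Y 1 / q by rewrite -[n.+1]add0n (acl_period gX mXY) (a_cl
      gX mXY).
    by field; nonzero gX.
  by rewrite (a_cl gX mXY); [ring | move: ne lein; lia].
- by move=> i lein; rewrite !pi_fext ?(leqW lein) // pi_f_rec.
- move=> [|i] lein; last first.
    by rewrite -[LHS]/(qg (pit n q qhalf qroot Y) i.+1) qg_pit.
  rewrite muln0; apply: (g0_prod (X := s1' (pi_ X))) => [|k|].
  + have gX' := generic_s1'pi gX; rewrite b_pit //.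
    by rewrite !mulf_neq0 ?invr_neq0 ?a0 //; nonzero gX'.
  + exact: qg_pit.
  rewrite (eq_bigr (fun i : 'I_n.+1 => qa Y i.+1 / qrho Y / ph (s1' (pi_ X)) (2 *
    i))); last first.
    by move=> i _; rewrite b_pit // -ltnS.
  rewrite !prodf_div prodr_const card_ord rhoY prod_ph_s1'pi_even.
  have := prod_g gX mXY; rewrite prodf_div prod_b prod_qab => E.
  have P0 : \prod_(i < n.+1) P (2 * i) != 0.
    by apply: gX; apply: subfree_prod => k; subfree_tac.
  have := qhalf_sqr n q_sqr q_neq0; have := prod_qa_neq0; have := prod_qb_neq0.
  move: P0 E; move: (qhalf ^ _) (\prod_i ph X _) (\prod_i qa Y _) (\prod_i qb Y _).
  move=> s pp pa pb pp0 E pb0 pa0 s2.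
  have e2 : ((-1) ^+ n.+1) ^+ 2 = 1 :> F by rewrite sqrr_sign.
  (* The product formula sought is multiplied by the one known for [Y]: the signs square to 1, and
     the prefactor squares to q^(n-2). *)
  have nzE : s * qt Y * (q * pb / pp) != 0 by rewrite E signr_eq0.
  apply: (mulIf nzE); rewrite {2}E -expr2 e2.
  rewrite -[qt _]/(q ^+ 2 / qt Y).
  transitivity (s ^+ 2 * q ^+ 2 / q ^+ n).
    by field; nonzero gX.
  by rewrite s2; field; nonzero gX.
Qed.

(** The extra 1/q in the image of b_(n+1) is accounted for by the factor [qroot] in the image of
    [qrho]. *)
Lemma pit_rho : rho_ok n q (pit n q qhalf qroot Y).
Proof.
have q_neq0 := q0 gX mXY; have p_neq0 := qrho_neq0.
rewrite /rho_ok big_add1 /= big_mkord big_split /=.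
rewrite big_split /= [\prod_(i < n.+1) (if _ then _ else _)]big_ord_recr /= eqxx.
rewrite (eq_bigr (fun i : 'I_n => qa Y i.+2 / qrho Y)); last first.
  by move=> i _; rewrite ifN // neq_ltn ltnS ltn_ord.
rewrite !big_split /= !prodr_const !card_ord exprVn exprMn q_root rhoY.
rewrite prod_qab; have := prod_qa_neq0; have := prod_qb_neq0.
pose pb := \prod_(i < n.+1) qb Y i.+1; pose pa := \prod_(i < n) qa Y i.+2.
have -> : \prod_(i < n.+1) qa Y i.+1 = qa Y 1 * pa by rewrite big_ord_recl.
rewrite -[\prod_(i < n.+1) b_ n q Y i.+1]/pb -/pb -/pa mulf_eq0 negb_or => pb0
  /andP[a0 pa0].
transitivity (q ^+ n * pb * (qa Y 1 * pa) / (q * ((qrho Y) ^+ n.+1 * (qrho Y) ^+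
  n.+1))).
  have -> : qrho Y ^+ n.+1 = q ^+ n * (qa Y 1 * pa * pb).
    by rewrite rhoY prod_qab big_ord_recl.
  by field; nonzero gX.
by rewrite !exprVn exprSr; field; nonzero gX.
Qed.

Lemma pit_identified :
  identified q qhalf (s1' (pi_ X)) (pit n q qhalf qroot Y).
Proof.
exact: matched_identified (generic_s1'pi gX) pit_matched pit_rho.
Qed.

End PiTilde.

(** * The reflections *)

(** Reduces the index comparisons in [r] to linear arithmetic; the bound 2N suffices because only
    neighbours of indices up to 2n+2 occur. *)
Lemma eq_mod_lt2 N k m : (k < 2 * N)%N -> (m < 2 * N)%N ->
  (k == m %[mod N])%N = [|| k == m, k == (m + N)%N | m == (k + N)%N].
Proof.
have E l : (l < 2 * N)%N -> (l %% N)%N = (if (l < N)%N then l else (l - N)%N).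
  move=> ltl; case: ltnP => leN; first by rewrite modn_small.
  by rewrite -{1}(subnK leN) modnDr modn_small //; lia.
by move=> ltk ltm; rewrite !E //; case: ltnP => ?; case: ltnP => ?; lia.
Qed.

Section Reflections.
Variables (n : nat) (F : fieldType).
Implicit Types (X : apoint n F) (i k m h : nat).

Lemma natr_pred_eq k m :
  (k%:R == m%:R - 1 :> 'I_(2 * n).+2) = (k.+1%:R == m%:R :> 'I_(2 * n).+2).
Proof. by rewrite -[in RHS]natr1 -[RHS](inj_eq (addIr (-1))) addrK. Qed.

Lemma al_r X m k : (m < (2 * n).+2)%N -> (k <= (2 * n).+2)%N ->
  al (r m%:R X) k
  = if (k == m) || (k == (m + (2 * n).+2)%N) then (al X m)^-1
    else if [|| k == m.+1, m.+1 == (k + (2 * n).+2)%N, k.+1 == m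
             | k.+1 == (m + (2 * n).+2)%N]
    then al X k * al X m else al X k.
Proof.
move=> ltm lek; rewrite /al /= natr_pred_eq natr1 !natr_eq !eq_mod_lt2; try lia.
have -> : [|| k == m, k == m + (2 * n).+2 | m == k + (2 * n).+2]%N
  = (k == m) || (k == (m + (2 * n).+2)%N) by lia.
case: ifP => // H; congr (if _ then _ else _); lia.
Qed.

Definition ratio X m : F := (al X m + ph X m) / (1 + ph X m).

(** For n >= 1 the classes of m-1, m and m+1 are distinct, so the exponents never overlap. The value
    k = 2n+2 is included because the relation for f at i = n mentions phi_(2n+2). *)
Lemma ph_r X m k : (0 < n)%N -> (m < (2 * n).+2)%N -> (k <= (2 * n).+2)%N ->
  ph (r m%:R X) k
  = if (k == m) || (k == (m + (2 * n).+2)%N) then ph X k / al X m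
    else if (k == m.+1) || (m.+1 == (k + (2 * n).+2)%N)
      then ph X k * al X m / ratio X m
    else if (k.+1 == m) || (k.+1 == (m + (2 * n).+2)%N) then ph X k * ratio X m
    else ph X k.
Proof.
move=> n0 ltm lek; rewrite /ph /ratio /al /ph /= natr_pred_eq natr1 !natr_eq
  !eq_mod_lt2; try lia.
set b1 := [|| k == m, _ | _]; set b2 := [|| k == m.+1, _ | _]; set b3 := [|| k.+1 ==
  m, _ | _].
have -> : (k == m) || (k == (m + (2 * n).+2)%N) = b1 by rewrite /b1; lia.
have [B1|B1] := boolP b1.
  have -> : b2 = false by move: B1; rewrite /b1 /b2; lia.
  have -> : b3 = false by move: B1; rewrite /b1 /b3; lia.
  by rewrite expr0z mulr1 addr0.
case: ifP => B2.
  have -> : b2 = true by rewrite /b2; lia.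
  have -> : b3 = false by move: B2; rewrite /b3; lia.
  by rewrite add0r expr1z.
case: ifP => B3.
  have -> : b2 = false by move: B1 B2; rewrite /b1 /b2; lia.
  have -> : b3 = true by rewrite /b3; lia.
  by rewrite expr0z mulr1 subr0 expr1z.
have -> : b2 = false by move: B1 B2; rewrite /b1 /b2; lia.
have -> : b3 = false by move: B1 B3; rewrite /b1 /b3; lia.
by rewrite !expr0z !mulr1.
Qed.

Lemma generic_r X m : (0 < n)%N -> (m < (2 * n).+2)%N -> generic X ->
  generic (r m%:R X).
Proof.
move=> n0 ltm; apply: generic_trans => i; rewrite -[i]natr_Zp.
  rewrite -/(al (r m%:R X) i) al_r ?(ltnW (ltn_ord i)) //.
  by repeat case: ifP => _; subfree_tac.
rewrite -/(ph (r m%:R X) i) ph_r ?(ltnW (ltn_ord i)) // /ratio.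
by repeat case: ifP => _; subfree_tac.
Qed.

End Reflections.

Ltac decide_ifs :=
  repeat first [rewrite orTb | rewrite ifT; last lia | rewrite ifF; last lia].

(** * Reflections with even index: exchanges of parameters with f and g fixed *)

Section EvenReflections.
Variables (n : nat) (F : fieldType) (q qhalf : F).
Hypotheses (q_sqr : qhalf ^+ 2 = q) (n_gt0 : (0 < n)%N).
Variables (X : apoint n F) (Y : qpoint F) (h : nat).
Hypotheses (gX : generic X) (mXY : matched q qhalf X Y) (rhoY : rho_ok n q Y).
Hypothesis lehn : (h <= n)%N.
Implicit Types (i : nat).

Local Notation X' := (r (2 * h)%:R X).
Local Notation Y' := (rt_even n q h Y).

Lemma b_rt_even i : (i <= n)%N ->
  b_ n q Y' i = if i == h then qa Y h.+1 else b_ n q Y i.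
Proof.
have nq := q0 gX mXY.
case: i => [|i] lein; rewrite /b_ /=; have [h0|h0] := eqVneq h 0%N.
- by rewrite h0 !eqxx mulrC divfK.
- by decide_ifs.
- by rewrite h0; decide_ifs.
- by case: eqP => // ->.
Qed.

Lemma rt_even_rho : rho_ok n q Y'.
Proof.
rewrite /rho_ok [LHS]rhoY; congr (_ * _).
have nq := q0 gX mXY.
rewrite !big_add1 /= !big_mkord !big_split /=.
(* Multiplication by q replaces b_1, ..., b_(n+1) by b_0, ..., b_n, on which the exchange of b_h and
   a_(h+1) is a plain transposition even for h = 0. *)
apply: (mulfI nq); rewrite !mulrA ![q * _]mulrC -!mulrA -!prod_b.
rewrite -[\prod_(i < n.+1) (if h == 0%N then _ else _)]/(\prod_(i < n.+1) qb Y' i.+1)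
  -prod_b.
have h' : (h < n.+1)%N by [].
rewrite -!big_split /=; apply: eq_bigr => i _.
rewrite b_rt_even ?leq_ord // eqSS; case: eqP => [->|//]; exact: mulrC.
Qed.

Lemma rt_even_matched : matched q qhalf X' Y'.
Proof.
have [a0 bE aE fE gE] := mXY; have nq := q0 gX mXY.
have lt2h : (2 * h < (2 * n).+2)%N by lia.
split.
- by move=> i lein /=; case: ifP => _; rewrite ?a0 // (matched_b gX mXY).
- move=> i lein; rewrite b_rt_even // al_r //; last lia.
  rewrite /= eqSS; have [->|ne] := eqVneq i h; decide_ifs; last exact: bE.
  by rewrite bE //; field; nonzero gX.
- move=> i lein; rewrite al_r //; last lia.
  rewrite /= eqSS; have [->|ne] := eqVneq i h.
    (* The entry b_(h+1) is untouched: for h = 0 the modified entry is b_(n+1), which is not b_1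
       because n >= 1. *)
    decide_ifs; have -> : (if h == 0%N then if h.+1 == n.+1 then qa Y 1 / q else qb Y
      h.+1 else if h.+1 == h then qa Y h.+1 else qb Y h.+1) = qb Y h.+1.
      by case: ifP => ?; decide_ifs.
    by rewrite bE // {1}aE //; ring.
  have [h0|h0] := eqVneq h 0%N; last first.
    have [Ei|ne'] := eqVneq i.+1 h; decide_ifs; last exact: aE.
    have := bE h lehn; rewrite -Ei b_S => bE'.
    by rewrite aE // bE'; ring.
  have [Ei|ne'] := eqVneq i n; decide_ifs; last exact: aE.
  rewrite aE // Ei.
  have := bE 0%N isT; rewrite h0 muln0 /b_ eqxx => bE'.
  by rewrite -[qb Y n.+1](mulKf nq) bE'; ring.
- move=> i lein; rewrite -[fext n Y' i]/(fext n Y i) -[fext n Y' i.+1]/(fext n Y i.+1).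
  (* The f_i can stay fixed because r_(2h) preserves (1 + phi_(2h)) phi_(2h+1) and phi_(2h-1)
     phi_(2h)/(1 + phi_(2h)), the two combinations containing phi_(2h) in the relations for f. The
     case h = 0, i = n is the cyclic predecessor. *)
  have r0 m : ratio X m != 0 by apply: gX; rewrite /ratio; subfree_tac.
  have := fE i lein; rewrite !ph_r //; try lia.
  have [Ei|ne] := eqVneq i h.
    decide_ifs; rewrite Ei => E; rewrite E /ratio; have nz : al X (2 * h) + ph X (2 *
      h) != 0 by nonzero gX.
    by field; nonzero gX.
  have [Ei|ne'] := eqVneq i.+1 h.
    decide_ifs; rewrite -Ei mulnS /ratio => E.
    have nz : 1 + ph X (2 * i).+2 != 0 by nonzero gX.
    by rewrite -[fext n Y i](mulfK nz) E; field; nonzero gX.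
  have [/andP[/eqP h0 /eqP Ei]|ne2] := boolP ((h == 0%N) && (i == n)).
    decide_ifs; rewrite h0 Ei muln0 /ratio ph_2n2 => E.
    have nz : 1 + ph X 0 != 0 by nonzero gX.
    by rewrite -[fext n Y n](mulfK nz) E; field; nonzero gX.
  by decide_ifs.
- move=> i lein; rewrite -[g_ n qhalf Y' i]/(g_ n qhalf Y i) gE // b_rt_even //.
  rewrite ph_r //; last lia.
  have [->|ne] := eqVneq i h; decide_ifs => //.
  by rewrite bE //; field; nonzero gX.
Qed.

End EvenReflections.

(** * Reflections with odd index: evaluation of the quantities R *)

Section OddReflections.
Variables (n : nat) (F : fieldType) (q qhalf : F).
Hypotheses (q_sqr : qhalf ^+ 2 = q) (n_gt0 : (0 < n)%N).
Variables (X : apoint n F) (Y : qpoint F) (h : nat).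
Hypotheses (gX : generic X) (mXY : matched q qhalf X Y) (rhoY : rho_ok n q Y).
Hypothesis lehn : (h <= n)%N.
Implicit Types (i : nat).

Local Notation X' := (r (2 * h).+1%:R X).
Local Notation Y' := (rt_odd n q qhalf h Y).
Local Notation R x y w := (R_ n q qhalf Y x y w h.+1).
Local Notation a := (qa Y).
Local Notation b := (qb Y).
Local Notation al1 := (al X (2 * h).+1).
Local Notation ph0 := (ph X (2 * h)).
Local Notation ph1 := (ph X (2 * h).+1).
Local Notation ph2 := (ph X (2 * h).+2).

(** One formula for all h: the special shape of R_(n+1) is the case f_(n+1) = 1 with g_0/q =
    -b_(n+1)/phi_0. *)
Definition Rodd x y w : F :=
  (- b h.+1 / ph2 - x) / fext n Y h.+1 + (- y * ph0 - w) / f_ Y h.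

Lemma RoddE (x y w : nat -> F) : R x y w = Rodd (x h.+1) (y h.+1) (w h.+1).
Proof.
have [a0 bE aE fE gE] := mXY; have nq := q0 gX mXY.
have b0 i (lein : (i <= n)%N) := matched_b gX mXY lein.
have E : b_ n q Y h / g_ n qhalf Y h = - ph0.
  by rewrite gE //; have nz := b0 h lehn; field; nonzero gX.
rewrite /R_ /Rodd /fext eqSS; case: eqP => [Eh|/eqP ne].
  rewrite !Eh; rewrite Eh in E; rewrite E gE // muln0 ph_2n2 {1}/b_ eqxx divr1.
  have nzf : f_ Y n != 0 by rewrite (f_cl gX mXY) ?(fcl0 gX mXY).
  by field; nonzero gX.
rewrite /= E -[g_ n qhalf Y h.+1]/(g_ n qhalf Y h.+1) gE; last by move: ne lehn; lia.
by rewrite mulnS b_S /=; ring.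
Qed.

Lemma fext_neq0 i : (i <= n.+1)%N -> fext n Y i != 0.
Proof.
move=> lei; rewrite /fext; case: (i =P n.+1) => [_|/eqP ne]; first exact: oner_neq0.
by rewrite (f_cl gX mXY) ?(fcl0 gX mXY) //; move: ne lei; lia.
Qed.

Lemma f_odd : f_ Y h = fext n Y h.+1 * ((1 + ph0) * ph1 * ph2) / (1 + ph2).
Proof.
have [_ _ _ fE _] := mXY; have nz : 1 + ph2 != 0 by nonzero gX.
by rewrite -fE // mulfK // /fext ifN // neq_ltn ltnS lehn.
Qed.

Lemma a_odd : a h.+1 = al1 * b h.+1.
Proof. by have [_ _ aE _ _] := mXY; apply: aE. Qed.

Let f0 := fext_neq0 (i := h.+1) lehn.
Let b0 : b h.+1 != 0 := matched_qb mXY lehn.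

(** Of the four evaluations, [R_baa] over [R_bbb] is the ratio (alpha + phi)/(1 + phi) of the
    reflection, while [R_bab] and [R_aaa] contain 1 + phi_(2h) and 1 + phi_(2h+2) after
    reflection. *)
Lemma R_bbb : R b b b = - b h.+1 * (1 + ph0) * (1 + ph1) / f_ Y h.
Proof. by rewrite RoddE /Rodd f_odd; field; nonzero gX. Qed.

Lemma R_baa : R b a a = - b h.+1 * (1 + ph0) * (ph1 + al1) / f_ Y h.
Proof. by rewrite RoddE /Rodd f_odd a_odd; field; nonzero gX. Qed.

Lemma R_bab : R b a b = - b h.+1 * (1 + ph1 + ph0 * (al1 + ph1)) / f_ Y h.
Proof. by rewrite RoddE /Rodd f_odd a_odd; field; nonzero gX. Qed.

Lemma R_aaa : R a a a
  = - b h.+1 * (1 + ph0) * (al1 + ph1 + ph2 * al1 * (1 + ph1)) / (1 + ph2) / f_ Y h.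
Proof. by rewrite RoddE /Rodd f_odd a_odd; field; nonzero gX. Qed.

Local Notation rho := (ratio X (2 * h).+1).

Let lt2h : ((2 * h).+1 < (2 * n).+2)%N. Proof. by rewrite !ltnS leq_mul2l lehn orbT.
  Qed.

Let rho0 : rho != 0. Proof. by apply: gX; rewrite /ratio; subfree_tac. Qed.

Let fh0 : f_ Y h != 0.
Proof. by rewrite (f_cl gX mXY) ?(fcl0 gX mXY). Qed.

Lemma b_rt_odd i : (i <= n)%N ->
  b_ n q Y' i = if (i == h.+1) || ((i == 0%N) && (h == n)) then al1 * b_ n q Y i
                else b_ n q Y i.
Proof.
case: i => [|i] lein; rewrite /b_ /=.
  rewrite eqSS eq_sym; case: eqP => [Eh|//]; rewrite -[qa Y n.+1]/(a n.+1).
  have <- : a h.+1 = a n.+1 by rewrite Eh.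
  have <- : b h.+1 = b n.+1 by rewrite Eh.
  by rewrite a_odd; ring.
by rewrite orbF eqSS; case: eqP => [->|//]; exact: a_odd.
Qed.

Lemma ph_odd_even i : (i <= n.+1)%N ->
  ph X' (2 * i)
  = if (i == h) || ((i == n.+1) && (h == 0%N)) then ph X (2 * i) * rho
    else if (i == h.+1) || ((i == 0%N) && (h == n)) then ph X (2 * i) * al1 / rho
    else ph X (2 * i).
Proof.
move=> lei; rewrite ph_r //; last lia.
have [C1|C1] := boolP ((i == h) || ((i == n.+1) && (h == 0%N))); first by decide_ifs.
by have [C2|C2] := boolP ((i == h.+1) || ((i == 0%N) && (h == n))); decide_ifs.
Qed.

Lemma ph_odd_odd i : (i <= n)%N ->
  ph X' (2 * i).+1 = if i == h then ph X (2 * i).+1 / al1 else ph X (2 * i).+1.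
Proof.
by move=> lei; rewrite ph_r //; [have [->|ne] := eqVneq i h; decide_ifs | lia].
Qed.

(** Up to a factor independent of i, this is the change of the tail product of phi_(2j+1) phi_(2j+2)
    over j >= i. *)
Let e i : F := if (i == h) || ((i == n.+1) && (h == 0%N)) then rho^-1 else 1.

(** The three cases in the rule for f differ only by the overall factor [lam], which cancels in the
    relation between f_i and f_(i+1). *)
Lemma f_rt_odd : exists lam, forall i, (i <= n.+1)%N ->
  fext n Y' i
  = fext n Y i * ((1 + ph X' (2 * i)) / (1 + ph X (2 * i))) * e i * lam.
Proof.
pose mu1 := R b a b / R b a a; pose mu2 := R a a a / R b a a.
have mu1E : mu1 = (1 + ph0 * rho) / (1 + ph0) / rho.
  rewrite /mu1 R_bab R_baa /ratio.
  have nz : ph1 + al1 != 0 by nonzero gX.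
  have nz' : al1 + ph1 != 0 by nonzero gX.
  by field; nonzero gX.
have mu2E : mu2 = (1 + ph2 * al1 / rho) / (1 + ph2).
  rewrite /mu2 R_aaa R_baa /ratio.
  by field; nonzero gX.
have mu1_0 : mu1 != 0.
  rewrite mu1E; apply: gX; rewrite /ratio; subfree_tac.
have mu2_0 : mu2 != 0.
  rewrite mu2E; apply: gX; rewrite /ratio; subfree_tac.
have baa_0 : R b a a != 0 by move: mu1_0; rewrite mulf_eq0 invr_eq0 negb_or => /andP[].
have bab_0 : R b a b != 0 by move: mu1_0; rewrite mulf_eq0 invr_eq0 negb_or => /andP[].
have aaa_0 : R a a a != 0 by move: mu2_0; rewrite mulf_eq0 invr_eq0 negb_or => /andP[].
have factorE i : (i <= n.+1)%N ->
    (1 + ph X' (2 * i)) / (1 + ph X (2 * i)) * e i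
    = if (i == h) || ((i == n.+1) && (h == 0%N)) then mu1
      else if (i == h.+1) || ((i == 0%N) && (h == n)) then mu2 else 1.
  move=> lei; rewrite /e ph_odd_even //; case: ifP => C1.
    have -> : ph X (2 * i) = ph0.
      case/orP: C1 => [/eqP-> //|/andP[/eqP-> /eqP->]].
      by rewrite mulnS ph_2n2 muln0.
    by rewrite mu1E.
  rewrite mulr1; case: ifP => C2; last by rewrite divff //; nonzero gX.
  have -> : ph X (2 * i) = ph2.
    case/orP: C2 => [/eqP->|/andP[/eqP-> /eqP->]]; first by rewrite mulnS.
    by rewrite muln0 ph_2n2.
  by rewrite mu2E.
(* Without this factor both f_0 = t and f_(n+1) = 1 would be multiplied by [mu1] when h = 0 and by
   [mu2] when h = n, although they have to stay fixed. *)
exists (if h == 0%N then mu1^-1 else if h == n then mu2^-1 else 1) => i lei.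
rewrite -(mulrA (fext n Y i)) factorE // -mulrA.
have [Ei|ne] := eqVneq i n.+1.
  rewrite Ei /fext eqxx mul1r; have [h0|h0] := eqVneq h 0%N; first by decide_ifs;
    rewrite divff.
  by have [hn|hn] := eqVneq h n; decide_ifs; rewrite ?divff ?mulr1.
have fextE Z : fext n Z i = f_ Z i by rewrite /fext (negPf ne).
rewrite !fextE; case: i => [|i] in lei ne fextE *.
  rewrite -[f_ Y' 0]/(f_ Y 0) -[LHS]mulr1; congr (_ * _).
  have [h0|h0] := eqVneq h 0%N; first by decide_ifs; rewrite divff.
  by have [hn|hn] := eqVneq h n; decide_ifs; rewrite ?divff ?mulr1.
rewrite -[f_ Y i.+1]/(qf Y i.+1) {1}/f_ /=; congr (_ * _).
have [h0|h0] := eqVneq h 0%N.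
  rewrite eqSS; case: (i =P 0%N) => [Ei|/eqP Ei]; decide_ifs.
    by rewrite /mu1 /mu2; field; rewrite bab_0 baa_0.
  by rewrite mul1r /mu1 invf_div.
have [hn|hn] := eqVneq h n.
  have [Ei|Ei] := eqVneq i.+1 n; decide_ifs.
    by rewrite /mu1 /mu2; field; rewrite aaa_0 baa_0.
  by rewrite mul1r /mu2 invf_div.
rewrite mulr1; have [Ei|Ei] := eqVneq i.+1 h; first by decide_ifs.
by have [Ei'|Ei'] := eqVneq i h; decide_ifs.
Qed.

Lemma prod_single m (x : F) : (m <= n)%N ->
  \prod_(i < n.+1) (if (i : nat) == m then x else 1) = x.
Proof.
move=> lem; rewrite -big_mkcond (big_pred1 (Ordinal (lem : (m < n.+1)%N))) //.
Qed.

(** The two correction factors sit at cyclic neighbours and are inverse to each other, so the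
    product over i, and with it the formula for g_0, is unchanged. *)
Lemma bph_rt_odd i : (i <= n)%N ->
  b_ n q Y' i / ph X' (2 * i)
  = b_ n q Y i / ph X (2 * i)
    * ((if i == h then rho^-1 else 1)
       * (if i == (if h == n then 0%N else h.+1) then rho else 1)).
Proof.
move=> lein; rewrite b_rt_odd // ph_odd_even ?(leqW lein) //.
have [Ei|Ei] := eqVneq i h.
  decide_ifs; have [hn|hn] := eqVneq h n; decide_ifs; field; nonzero gX.
have [hn|hn] := eqVneq h n.
  have [i0|i0] := eqVneq i 0%N; decide_ifs; field; nonzero gX.
have [Ei'|Ei'] := eqVneq i h.+1; decide_ifs; field; nonzero gX.
Qed.

Lemma rt_odd_rho : rho_ok n q Y'.
Proof.
rewrite /rho_ok [LHS]rhoY; congr (_ * _); rewrite !big_add1 /= !big_mkord.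
by apply: eq_bigr => i _; rewrite eqSS; case: eqP => // ->; rewrite mulrC.
Qed.

Lemma qg_rt_odd i : (0 < i <= n)%N ->
  qg Y' i = - b_ n q Y' i / ph X' (2 * i).
Proof.
case/andP=> i0 lein; have [_ _ _ _ gE] := mXY.
have baa_bbb : R b b b / R b a a = rho^-1.
  rewrite R_bbb R_baa /ratio.
  have nz : ph1 + al1 != 0 by nonzero gX.
  by field; nonzero gX.
have bbb_baa : R b a a / R b b b = rho by rewrite -[RHS]invrK -baa_bbb invf_div.
rewrite mulNr bph_rt_odd // -mulNr -mulNr -gE //.
have -> : g_ n qhalf Y i = qg Y i by rewrite /g_ ifN // -lt0n.
rewrite /= baa_bbb bbb_baa; congr (_ * _).
have [h0|h0] := eqVneq h 0%N.
  rewrite (_ : (h == n) = false); last lia.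
  by have [Ei|Ei] := eqVneq i 1%N; decide_ifs; rewrite ?mul1r ?mulr1.
have [hn|hn] := eqVneq h n.
  by have [Ei|Ei] := eqVneq i n; decide_ifs; rewrite ?mul1r ?mulr1.
have [Ei|Ei] := eqVneq i h.
  have -> : (i == h.+1) = false by lia.
  by rewrite subr0 expr1z mulr1.
have [Ei'|Ei'] := eqVneq i h.+1; first by rewrite sub0r mul1r exprN1 invrK.
by rewrite subr0 expr0z mulr1.
Qed.

Lemma rt_odd_matched : matched q qhalf X' Y'.
Proof.
have [a0 bE aE fE gE] := mXY; have nq := q0 gX mXY.
have nb i (lein : (i <= n)%N) := matched_b gX mXY lein.
split.
- by move=> i lein /=; case: ifP => _; rewrite ?a0 // (matched_qb mXY).
- move=> i lein; rewrite b_rt_odd // al_r //; last lia.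
  rewrite /= eqSS; have [->|ne] := eqVneq i h.
    decide_ifs; rewrite bE // a_odd; ring.
  have [C|C] := boolP ((i == h.+1) || ((i == 0%N) && (h == n))); decide_ifs.
    by rewrite bE //; ring.
  exact: bE.
- move=> i lein; rewrite al_r //; last lia.
  rewrite /= eqSS; have [->|ne] := eqVneq i h; decide_ifs; last exact: aE.
  by rewrite a_odd; field; nonzero gX.
- move=> i lein; have [lam fE'] := f_rt_odd; rewrite !fE' ?(leqW lein) //.
  have gX' : generic X' by apply: generic_r.
  have rel : e i * (ph X (2 * i).+1 * ph X (2 * i).+2)
       = e i.+1 * (ph X' (2 * i).+1 * ph X' (2 * i).+2).
    have := ph_odd_even (lein : (i.+1 <= n.+1)%N); rewrite mulnS => ->.
    rewrite ph_odd_odd // /e.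
    have [Ei|ne] := eqVneq i h.
      by rewrite Ei; decide_ifs; field; nonzero gX.
    have [C|C] := boolP ((i.+1 == h) || ((i.+1 == n.+1) && (h == 0%N))).
      by decide_ifs; field; nonzero gX.
    by decide_ifs.
  have := fE i lein; rewrite !mulnS => E.
  have nz : 1 + ph X (2 * i).+2 != 0 by nonzero gX.
  rewrite -[fext n Y i](mulfK nz) E.
  have -> : e i = e i.+1 * (ph X' (2 * i).+1 * ph X' (2 * i).+2)
      / (ph X (2 * i).+1 * ph X (2 * i).+2).
    by rewrite -rel; field; nonzero gX.
  by move: (e i.+1) => e1; field; nonzero gX.
- move=> [|i] lein; last by rewrite -[LHS]/(qg Y' i.+1) qg_rt_odd.
  have gX' : generic X' by apply: generic_r.
  rewrite muln0; apply: (g0_prod (X := X')) => [|k|].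
  + rewrite mulf_neq0 ?invr_neq0 //; last by nonzero gX'.
    by rewrite b_rt_odd //; case: ifP => _; rewrite ?nb //; apply: mulf_neq0; rewrite
      ?nb //; nonzero gX.
  + exact: qg_rt_odd.
  rewrite (eq_bigr (fun i : 'I_n.+1 => b_ n q Y i / ph X (2 * i) *
     ((if (i : nat) == h then rho^-1 else 1)
       * (if (i : nat) == (if h == n then 0%N else h.+1) then rho else 1)))); last
         first.
    by move=> i _; rewrite bph_rt_odd ?leq_ord.
  rewrite !big_split /= !prod_single //; last by case: eqP lehn => //; lia.
  by rewrite mulVf // mulr1 -big_split /= (prod_g gX mXY).
Qed.

End OddReflections.

Lemma r_identified n (F : fieldType) (q qhalf : F) (X : apoint n F) (Y : qpoint F)
    (j : 'I_(2 * n).+2) :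
  qhalf ^+ 2 = q -> (0 < n)%N -> generic X -> identified q qhalf X Y ->
  identified q qhalf (r j X) (rt n q qhalf j Y).
Proof.
move=> q_sqr n_gt0 gX idXY; have mXY := identified_matched gX idXY.
have rhoY := identified_rho idXY; rewrite -[j in r j _]natr_Zp.
have lt_j := ltn_ord j; have gX' := generic_r n_gt0 lt_j gX.
rewrite /rt; case: ifP => odd_j.
  have Ej : (j : nat) = (2 * j./2).+1 by lia.
  have lehn : (j./2 <= n)%N by lia.
  apply: (matched_identified q_sqr gX'); last exact: rt_odd_rho.
  by have := rt_odd_matched n_gt0 gX mXY lehn; rewrite -Ej.
have Ej : (j : nat) = (2 * j./2)%N by lia.
have lehn : (j./2 <= n)%N by lia.
apply: (matched_identified q_sqr gX'); last exact: rt_even_rho gX mXY rhoY lehn.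
by have := rt_even_matched n_gt0 gX mXY lehn; rewrite -Ej.
Qed.

(** * The translation tau_1 *)

Section Tau1.
Variables (n : nat) (F : fieldType) (X : apoint n F).
Hypothesis gX : generic X.
Implicit Types (i j k m : nat).

Local Notation A := (al X).
Local Notation P := (ph X).

(* [Tsum k] is S'_k after pi^-1 pi', which replaces phi by alpha/phi. *)
Definition Tsum k : F := cycsum (2 * n.+1) (fun l => (P l)^-1) (fun=> 1) k.
Local Notation T := Tsum.

Lemma subfree_Tsum k : subfree X (T k).
Proof. by rewrite /T mulnS; subfree_tac. Qed.

Lemma Tsum_neq0 k : T k != 0. Proof. by apply: gX; apply: subfree_Tsum. Qed.

Lemma Tsum_period k : T (k + (2 * n).+2) = T k.
Proof.
have -> : (k + (2 * n).+2 = k + 2 * n.+1)%N by lia.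
by apply: cycsum_periodic => l; rewrite ?mulnS ?ph_period.
Qed.

Lemma Tsum_rec k : T k - T k.+1 / P k = 1 - (beta0' X)^-1.
Proof.
rewrite [T k.+1 / _]mulrC /T cycsum_rec mulr1; congr (_ - _).
by rewrite mulnS prodfV prod_ph_shift.
Qed.

Definition Wpt : apoint n F := s1' (Defs.pi_inv (pi_' X)).
Local Notation W := (ph Wpt).

Lemma al_W k : al Wpt k = A k.
Proof. exact: al_pi_inv_pi'. Qed.

Lemma ph_W k : W k = A k * P k.+1 * (T k / T k.+2).
Proof.
rewrite ph_s1' !al_pi_inv_pi' ph_pi_inv_pi' !S'E.
have E i : cycsum (2 * n.+1) (fun l => ph (Defs.pi_inv (pi_' X)) l / al (Defs.pi_inv
  (pi_' X)) l) (fun=> 1) i = T i.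
  by apply: eq_cycsum => // l; rewrite ph_pi_inv_pi' al_pi_inv_pi'; field; nonzero gX.
rewrite !E; congr (_ * _).
by field; nonzero gX.
Qed.

Definition wratio i : F := A (2 * i) / W (2 * i).

Lemma wratioE i : wratio i = T (2 * i).+2 / (P (2 * i).+1 * T (2 * i)).
Proof.
rewrite /wratio ph_W; have n1 := Tsum_neq0 (2 * i); have n2 := Tsum_neq0 (2 * i).+2.
by field; nonzero gX.
Qed.

Lemma wratio_neq0 i : wratio i != 0.
Proof.
by rewrite wratioE mulf_neq0 ?invr_neq0 ?mulf_neq0 ?Tsum_neq0 //; nonzero gX.
Qed.

(** The recurrences of T at 2i and 2i+1 have the same right-hand side; equating their left-hand
    sides gives a linear relation between T_(2i), T_(2i+1) and T_(2i+2). *)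
Lemma one_wratio i : 1 + wratio i = (1 + (P (2 * i))^-1) * T (2 * i).+1 / T (2 * i).
Proof.
rewrite wratioE; have n1 := Tsum_neq0 (2 * i).
have E1 := Tsum_rec (2 * i); have E2 := Tsum_rec (2 * i).+1.
have -> : T (2 * i).+2 = P (2 * i).+1 * (T (2 * i).+1 - (T (2 * i) - T (2 * i).+1 / P
  (2 * i))).
  by rewrite E1 -E2; field; nonzero gX.
by field; nonzero gX.
Qed.

Lemma W_odd i : W (2 * i).+1 = A (2 * i).+1 * P (2 * i).+2 * (T (2 * i).+1 / T (2 *
  i).+3).
Proof. exact: ph_W. Qed.

(** Their product over a period is beta_0, the origin of the factor q^(n-1) t in the wrapped half of
    G_i. *)
Definition vratio m : F := A (2 * m).+1 * P (2 * m).+2 / P (2 * m).+1.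
Definition Vsum i : F := cycsum n.+1 vratio (fun m => 1 + (P (2 * m))^-1) i.
Local Notation V := Vsum.

Lemma subfree_Vsum i : subfree X (V i).
Proof. by rewrite /V /vratio; subfree_tac. Qed.

Lemma Vsum_neq0 i : V i != 0. Proof. by apply: gX; apply: subfree_Vsum. Qed.

Lemma vratio_period k : vratio (k + n.+1) = vratio k.
Proof.
rewrite /vratio al_odd_period ph_odd_period; congr (_ * _ / _).
by have := ph_even_period X k.+1; rewrite addSn !mulnS.
Qed.

Lemma Vsum_period i : V (i + n.+1) = V i.
Proof.
by apply: cycsum_periodic => k; rewrite ?vratio_period ?ph_even_period.
Qed.

Local Notation Se i := (Seven Wpt (2 * i)%:R).
Local Notation So i := (Sodd Wpt (2 * i).+1%:R).

(** The gauge T_(2m)/T_(2m+1) works twice: it reduces the ratios to [vratio], and by [one_wratio] it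
    reduces the weights to 1 + 1/phi_(2m). *)
Lemma Seven_Wpt i : Se i = T (2 * i).+1 / T (2 * i) * V i.
Proof.
pose h m := T (2 * m) / T (2 * m).+1.
have h0 k : h k != 0 by rewrite mulf_neq0 ?invr_neq0 ?Tsum_neq0.
rewrite SevenE (@eq_cycsum _ _ _ (fun m => vratio m * (h m.+1 / h m)) _ (fun m => 1 +
  wratio m)).
- rewrite cycsum_gauge // /V [RHS]mulrC /h invf_div; congr (_ * _).
  apply: eq_cycsum => // m; rewrite one_wratio.
  by have n1 := Tsum_neq0 (2 * m); have n2 := Tsum_neq0 (2 * m).+1; field; nonzero gX.
- move=> m; rewrite al_W -/(wratio m) wratioE W_odd /vratio /h mulnS.
  have n1 := Tsum_neq0 (2 * m); have n2 := Tsum_neq0 (2 * m).+1.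
  have n3 := Tsum_neq0 (2 * m).+2; have n4 := Tsum_neq0 (2 * m).+3.
  by field; nonzero gX.
- by move=> m; rewrite al_W.
Qed.

Lemma Seven_Sodd_Wpt i : Se i + W (2 * i).+1 * Se i.+1 = (1 + wratio i) * So i.
Proof.
have pu k : wratio (k + n.+1) = wratio k.
  by rewrite /wratio al_even_period ph_even_period.
have := cycsum_s1 (fun m => W (2 * m).+1) i wratio_neq0 pu => /= E.
have SeU j : Se j = cycsum n.+1 (fun m => wratio m * W (2 * m).+1) (fun m => 1 +
  wratio m) j.
  by rewrite SevenE; apply: eq_cycsum => m; rewrite al_W.
rewrite !SeU E SoddE; congr (_ * _); apply: eq_cycsum => // m.
by rewrite al_W /wratio mulnS.
Qed.

Lemma Sodd_Wpt_period i : So (i + n.+1) = So i.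
Proof. by rewrite mulnDr mulnS -addSn natr_period. Qed.

Lemma subfree_Seven_Wpt i : subfree X (Se i).
Proof.
by rewrite Seven_Wpt; repeat apply: subfree_mul; try apply: subfree_inv;
  rewrite ?Seven_Wpt; try apply: subfree_Tsum; apply: subfree_Vsum.
Qed.

Lemma subfree_Wpt k : subfree X (W k).
Proof.
by rewrite ph_W; repeat apply: subfree_mul; try apply: subfree_inv;
  subfree_tac; apply: subfree_Tsum.
Qed.

Lemma subfree_Sodd_Wpt i : subfree X (So i).
Proof.
by rewrite SoddE; apply: subfree_cycsum => m; rewrite ?al_W;
  repeat first [apply: subfree_Wpt | apply: subfree_al | apply: subfree_1
    | apply: subfree_mul | apply: subfree_add | apply: subfree_inv].
Qed.

Lemma Seven_Wpt_neq0 i : Se i != 0. Proof. by apply: gX; apply: subfree_Seven_Wpt. Qed.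
Lemma Sodd_Wpt_neq0 i : So i != 0. Proof. by apply: gX; apply: subfree_Sodd_Wpt. Qed.

Local Notation X'' := (tau1 X).

Lemma al_tau k : al X'' k = A k. Proof. exact: al_W. Qed.

Lemma ph_tau_even i : ph X'' (2 * i) = A (2 * i) * W (2 * i).+1 * (Se i.+1 / Se i).
Proof. by rewrite ph_s1_even al_W. Qed.

Lemma ph_tau_odd i : ph X'' (2 * i).+1 = So i / (wratio i.+1 * So i.+1).
Proof.
rewrite ph_s1_odd al_W /wratio mulnS; have n1 := Sodd_Wpt_neq0 i.+1.
rewrite mulnS in n1.
have n2 : W (2 * i).+2 != 0 by apply: gX; apply: subfree_Wpt.
by field; nonzero gX.
Qed.

Lemma generic_tau : generic X''.
Proof.
apply: (generic_trans _ _ gX) => i.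
  by rewrite -[i]natr_Zp -/(al X'' _) al_tau; subfree_tac.
rewrite -[i]natr_Zp -/(ph X'' _).
have hu k : subfree X (wratio k).
  by apply: subfree_mul; [subfree_tac | apply: subfree_inv; apply: subfree_Wpt].
case odd_i: (odd i).
  have -> : (i : nat) = (2 * i./2).+1 by lia.
  by rewrite ph_tau_odd; repeat first [apply: subfree_Sodd_Wpt | apply: hu
    | apply: subfree_mul | apply: subfree_inv].
have -> : (i : nat) = (2 * i./2)%N by lia.
by rewrite ph_tau_even; repeat first [apply: subfree_Seven_Wpt | apply: subfree_Wpt
  | apply: subfree_al | apply: subfree_mul | apply: subfree_inv].
Qed.

(** The T of odd index cancel. The remaining quotients of T and of V are those of the F's and of the
    G's in the equation for g_i. *)
Lemma ph_tau_evenV i : ph X'' (2 * i)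
  = A (2 * i) * A (2 * i).+1 * P (2 * i).+2
    * (T (2 * i) * V i.+1 / (T (2 * i).+2 * V i)).
Proof.
rewrite ph_tau_even W_odd !Seven_Wpt mulnS.
have n1 := Tsum_neq0 (2 * i); have n2 := Tsum_neq0 (2 * i).+1.
have n3 := Tsum_neq0 (2 * i).+2; have n4 := Tsum_neq0 (2 * i).+3.
have n5 := Vsum_neq0 i.
by field; nonzero gX.
Qed.

End Tau1.

(** * Comparison of tau_1 with the q-difference system *)

Section Tau1System.
Variables (n : nat) (F : fieldType) (q qhalf : F).
Hypotheses (q_sqr : qhalf ^+ 2 = q) (n_gt0 : (0 < n)%N).
Variables (X : apoint n F) (Y : qpoint F).
Hypotheses (gX : generic X) (mXY : matched q qhalf X Y) (rhoY : rho_ok n q Y).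
Implicit Types (i j k m : nat).

Local Notation A := (al X).
Local Notation P := (ph X).
Local Notation T := (Tsum X).
Local Notation V := (Vsum X).
Local Notation X'' := (tau1 X).
Local Notation P'' := (ph (tau1 X)).
Local Notation ac := (acl X Y).
Local Notation bc := (bcl X Y).
Local Notation gc := (gcl X Y).
Local Notation fc := (fcl X Y).
Local Notation Se i := (Seven (Wpt X) (2 * i)%:R).
Local Notation So i := (Sodd (Wpt X) (2 * i).+1%:R).

Lemma P''0 k : P'' k != 0.
Proof. by have gX'' := generic_tau gX; nonzero gX''. Qed.

(** The quotients of V/T cancel around the cycle and all alphas remain. Since the odd phi keep their
    product, this is the whole source of the shift of t to q t. *)
Lemma prod_P''_even :
  \prod_(i < n.+1) P'' (2 * i) = q * \prod_(i < n.+1) P (2 * i).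
Proof.
pose h m := V m / T (2 * m).
have h0 k : h k != 0 by rewrite mulf_neq0 ?invr_neq0 ?Tsum_neq0 ?Vsum_neq0.
rewrite (eq_bigr (fun i : 'I_n.+1 => A (2 * i) * A (2 * i).+1 * P (2 * (1 + i)) * (h
  i.+1 / h i))); last first.
  move=> i _; rewrite ph_tau_evenV // /h add1n mulnS.
  have n1 := Tsum_neq0 gX (2 * i); have n3 := Tsum_neq0 gX (2 * i).+2; have n5 :=
    Vsum_neq0 gX i.
  by field; nonzero gX.
rewrite (prod_ratio_periodic (fun l => A (2 * l) * A (2 * l).+1 * P (2 * (1 + l)))
  h0); last first.
  by rewrite /h -[n.+1]add0n Vsum_period mulnDr mulnS Tsum_period.
rewrite big_split /= -qprod_pairs -(q_prod gX mXY); congr (_ * _).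
by apply: (prod_periodic (c := fun m => P (2 * m))) => k; apply: ph_even_period.
Qed.

Lemma prod_P''_odd :
  \prod_(i < n.+1) P'' (2 * i).+1 = \prod_(i < n.+1) P (2 * i).+1.
Proof.
pose h m := (So m * T (2 * m).+2)^-1.
have h0 k : h k != 0 by rewrite invr_neq0 ?mulf_neq0 ?Sodd_Wpt_neq0 ?Tsum_neq0.
rewrite (eq_bigr (fun i : 'I_n.+1 => P (2 * (1 + i)).+1 * (h i.+1 / h i))); last first.
  move=> i _; rewrite ph_tau_odd // wratioE // /h add1n !mulnS.
  have n1 := Tsum_neq0 gX (2 * i).+2; have n3 := Tsum_neq0 gX (2 * i).+4.
  have n5 := Sodd_Wpt_neq0 gX i; have n6 := Sodd_Wpt_neq0 gX i.+1; rewrite mulnS in n6.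
  by field; nonzero gX.
rewrite (prod_ratio_periodic (fun l => P (2 * (1 + l)).+1) h0); last first.
  rewrite /h -[n.+1]add0n Sodd_Wpt_period mulnDr mulnS -[(2 * 0 + _).+2]/((2 * 0).+2
    + (2 * n).+2)%N.
  by rewrite Tsum_period.
by apply: (prod_periodic (c := fun m => P (2 * m).+1)) => k; apply: ph_odd_period.
Qed.

Lemma beta0'_tau : beta0' X'' = q * qt Y.
Proof.
rewrite (t_prod gX mXY) /beta0' !big_split /=.
rewrite -[LHS]/((\prod_(i < n.+1) P'' (2 * i)) * \prod_(i < n.+1) P'' (2 * i).+1).
by rewrite prod_P''_even prod_P''_odd mulrA.
Qed.

(** Together with [fbar], the values dictated by the identification after tau_1. The formula is also
    used at i = 0, where it is the shifted g_0 ([g0_bar]). *)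
Definition gbar i : F := - b_ n q Y i / P'' (2 * i).
Definition fbar i : F := (1 + P'' (2 * i)) / (1 + P'' 0) * ph_tail X'' i.

Lemma shifted_matched : matched q qhalf X'' (shifted q Y fbar gbar).
Proof.
have gX'' := generic_tau gX; have [a0 bE aE _ _] := mXY.
split.
- exact: a0.
- by move=> i lein; rewrite al_tau -bE.
- by move=> i lein; rewrite al_tau -aE.
- apply/(fext_closed _ gX'') => i lei; rewrite /fext; have [->|ne] := eqVneq i n.+1.
    by rewrite ph_tail_last mulnS ph_2n2 divff ?mulr1 //; nonzero gX''.
  case: i lei ne => [|i] lei ne //.
  by rewrite ph_tail0 beta0'_tau divff ?mul1r //; nonzero gX''.
- move=> [|i] lein //; rewrite muln0; apply: (g0_prod (X := X'')) => //.
    by apply: mulf_neq0; [exact: (matched_b gX mXY (leq0n n)) | rewrite invr_neq0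
      ?P''0].
  (* The q gained by the product of the even phi cancels the q in the shifted t, so the formula
     reduces to the one for [Y]. *)
  rewrite prodf_div prod_P''_even; have := prod_g gX mXY; rewrite prodf_div => <-.
  have nz : \prod_(i < n.+1) P (2 * i) != 0.
    by apply: gX; apply: subfree_prod => k; subfree_tac.
  have nq := q0 gX mXY.
  rewrite -[\prod_(i < n.+1) b_ n q (shifted _ _ _ _) i]/(\prod_(i < n.+1) b_ n q Y
    i) /=.
  by move: (qhalf ^ _) => s; field; nonzero gX.
Qed.

Lemma shifted_identified : identified q qhalf X'' (shifted q Y fbar gbar).
Proof. exact: matched_identified (generic_tau gX) shifted_matched rhoY. Qed.

(** A primitive of 1/(phi_(2m+1) phi_(2m+2)), normalised so that f_i = D_i (1 + phi_(2i)). *)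
Definition Dcl i : F := (1 + P 0)^-1 * (qt Y / \prod_(k < 2 * i) P k.+1).
Definition Fcl i : F := qt Y * Dcl i * P (2 * i) * T (2 * i).

Lemma F_cl i : (0 < i <= n.+1)%N -> F_ n Y i = Fcl i.
Proof.
case/andP=> i0 lei.
have t_neq0 := t0 gX mXY.
pose c m := (P (2 * m).+1 * P (2 * m).+2)^-1.
have TE : P (2 * i) * T (2 * i) = cycsum n.+1 c (fun m => 1 + P (2 * m)) i.
  (* Pairing gives ratios 1/(phi_(2m) phi_(2m+1)), which differ from [c] by phi_(2m+2)/phi_(2m); the
     gauge phi_(2m) moves this into the weights. *)
  rewrite /Tsum cycsum_pair (@eq_cycsum _ _ _ (fun m => c m * (P (2 * m.+1) / P (2 *
    m))) _ (fun m => 1 + (P (2 * m))^-1)) //; last first.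
    by move=> m; rewrite /c mulnS; field; nonzero gX.
  rewrite (@cycsum_gauge _ _ c (fun m => 1 + (P (2 * m))^-1) (fun m => P (2 * m)));
    last by move=> k; nonzero gX.
  rewrite mulrC divfK; last by nonzero gX.
  by apply: eq_cycsum => // m; field; nonzero gX.
have pc k : c (k + n.+1)%N = c k.
  rewrite /c ph_odd_period; congr (_ * _)^-1.
  by have := ph_even_period X k.+1; rewrite addSn !mulnS.
have recD k : Dcl k.+1 = Dcl k * c k.
  rewrite /Dcl /c mulnS !big_ord_recr /=; have nz := prod_ph_neq0 gX (2 * k).
  by field; nonzero gX.
rewrite /Fcl -mulrA TE -mulrA.
have fcE j : Dcl j * (1 + P (2 * j)) = fc j by rewrite /Dcl /fcl; ring.
have pd k : 1 + P (2 * (k + n.+1)) = 1 + P (2 * k) by rewrite ph_even_period.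
have E := @cycsum_unfold F n.+1 c (fun m => 1 + P (2 * m)) Dcl i lei pc pd recD.
rewrite E.
have -> : \prod_(l < n.+1) c l = (qt Y)^-1.
  rewrite prodfV (t_prod gX mXY) -ph_tail0; congr (_^-1).
  by rewrite /ph_tail big_mkord.
rewrite mulrDr mulVKf // /F_ addrC addrA addrC; congr (_ + _).
  congr (_ * _); apply: eq_big_nat => j /andP[leij ltj]; rewrite fcE.
  by rewrite -(f_cl gX mXY) // /f_ ifN // -lt0n (leq_trans i0).
rewrite [RHS]big_ltn // fcE -(f_cl gX mXY (leq0n n)); congr (_ + _) => //.
apply: eq_big_nat => j /andP[j0 ltj]; rewrite fcE -(f_cl gX mXY); last by lia.
by rewrite /f_ ifN // -lt0n.
Qed.

Local Notation ba k := (b_ n q Y k * qa Y k.+1).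
Local Notation s := (qhalf ^ (n%:Z - 2)).

Definition Bcl i : F := \prod_(0 <= k < i) ba k.
(** A primitive of [vratio]; the constant is fixed by j = 0 in [G_term], where g_0 ... g_n f_0 is
    the inverse of q^((n-2)/2). *)
Definition Ecl i : F := s^-1 / (1 + (P 0)^-1) * \prod_(k < i) vratio X k.

Lemma bcl0 i : bc i != 0.
Proof. by rewrite /bcl; have nz := acl0 gX mXY i; nonzero gX. Qed.

Lemma gcl0 i : gc i != 0.
Proof. by rewrite /gcl; have nz := bcl0 i; nonzero gX. Qed.

Lemma Bcl0 i : (i <= n.+1)%N -> Bcl i != 0.
Proof.
move=> lei; rewrite /Bcl big_mkord; apply/prodf_neq0 => k _.
have lekn : (k <= n)%N by have := ltn_ord k; lia.
by rewrite (b_cl' gX mXY) // (a_cl gX mXY) // mulf_neq0 ?bcl0 ?(acl0 gX mXY).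
Qed.

Lemma vratio_neq0 k : vratio X k != 0. Proof. by rewrite /vratio; nonzero gX. Qed.

Lemma qhalf_exp_neq0 : s != 0.
Proof.
by have := q0 gX mXY; rewrite -q_sqr expf_eq0 /= => z; rewrite expfz_neq0.
Qed.

Lemma Ecl0 i : Ecl i != 0.
Proof.
apply: mulf_neq0; last by apply/prodf_neq0 => k _; apply: vratio_neq0.
by have nz := qhalf_exp_neq0; nonzero gX.
Qed.

Lemma Bcl_rec j : Bcl j.+1 = Bcl j * ba j.
Proof. by rewrite /Bcl big_nat_recr. Qed.

Lemma Ecl_rec j : Ecl j.+1 = Ecl j * vratio X j.
Proof. by rewrite /Ecl big_ord_recr /= mulrA. Qed.

(** With g_0 included, the induction can start at 0. For j >= 1 it cancels and leaves a summand of
    G; for j = 0 it remains and gives the isolated term of G. *)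
Lemma G_term j : (j <= n)%N ->
  Bcl j * (g_ n qhalf Y 0 * \prod_(j.+1 <= l < n.+1) g_ n qhalf Y l)
    / (\prod_(0 <= l < j) g_ n qhalf Y l) * f_ Y j
  = Ecl j * (1 + (P (2 * j))^-1).
Proof.
have nzt := t0 gX mXY; have nzs := qhalf_exp_neq0.
elim: j => [|j IH] lej.
  rewrite /Bcl /Ecl big_ord0 ![\prod_(0 <= _ < 0) _]big_geq // muln0.
  have -> : \prod_(1 <= l < n.+1) g_ n qhalf Y l = \prod_(1 <= l < n.+1) qg Y l.
    by apply: eq_big_nat => l /andP[l0 _]; rewrite /g_ ifN // -lt0n.
  have := gcl0 0; rewrite -(g_cl gX mXY) // /g_ eqxx invr_eq0 !mulf_eq0 !negb_or.
  move=> /andP[/andP[n1 n2] n3]; rewrite /f_ eqxx.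
  by field; nonzero gX.
have := IH (ltnW lej); rewrite Bcl_rec Ecl_rec.
rewrite [\prod_(j.+1 <= _ < _) _]big_ltn // [\prod_(0 <= _ < j.+1) _]big_nat_recr //=
  mulnS.
have lejn := ltnW lej.
rewrite (b_cl' gX mXY lejn) (a_cl gX mXY lejn) (g_cl gX mXY lej) (g_cl gX mXY lejn).
rewrite (f_cl gX mXY lej) (f_cl gX mXY lejn).
move=> IHj.
have nzG : \prod_(0 <= l < j) g_ n qhalf Y l != 0.
  rewrite big_mkord; apply/prodf_neq0 => k _; rewrite (g_cl gX mXY) ?gcl0 //.
  by have := ltn_ord k; lia.
have nzg := gcl0 j; have nzg' := gcl0 j.+1; have nzf := fcl0 gX mXY j.
have nz1 : 1 + (P (2 * j))^-1 != 0 by nonzero gX.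
have step : bc j * ac j * fc j.+1 / (gc j * gc j.+1)
   = vratio X j * (1 + (P (2 * j).+2)^-1) / (1 + (P (2 * j))^-1) * fc j.
  have nz : 1 + P (2 * j).+2 != 0 by nonzero gX.
  rewrite -[fc j](mulfK nz) fcl_rec // /gcl /vratio /bcl (aclE Y gX j) /bcl mulnS.
  have nza := acl0 gX mXY j.+1.
  by field; nonzero gX.
move: (\prod_(j.+2 <= l < _) _) (\prod_(0 <= l < j) _) nzG IHj => g1 g2 nzG IHj.
transitivity (Bcl j * (g_ n qhalf Y 0 * (gc j.+1 * g1)) / g2 * fc j / fc j
   * (bc j * ac j * fc j.+1 / (gc j * gc j.+1))); first by field; nonzero gX.
by rewrite IHj step; field; nonzero gX.
Qed.

Lemma prod_vratio : \prod_(l < n.+1) vratio X l = q ^+ n.-1 * qt Y * Bcl n.+1.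
Proof.
have [_ [bE _ _] _ _ _] := matched_identified q_sqr gX mXY rhoY.
have -> : \prod_(l < n.+1) vratio X l = beta0 X.
  rewrite /vratio prodf_div big_split /=.
  have -> : \prod_(l < n.+1) P (2 * l).+2 = \prod_(l < n.+1) P (2 * l).
    rewrite -(prod_periodic (c := fun m => P (2 * m)) 1 (ph_even_period X)).
    by apply: eq_bigr => l _; rewrite add1n mulnS.
  by rewrite /beta0 prodf_div big_split /= [X in X / _]mulrC.
rewrite -bE /Bcl big_mkord big_add1 /= big_mkord !big_split /= prod_b.
by rewrite -[in q ^+ n](prednK n_gt0) exprS; ring.
Qed.

Lemma qhalf_exp : qhalf ^+ n = q ^+ n.-1 / s.
Proof.
have nz := qhalf_exp_neq0; have nq := q0 gX mXY.
apply: (mulIf nz); rewrite divfK //.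
have qh0 : qhalf != 0 by move: nq; rewrite -q_sqr expf_eq0.
rewrite -q_sqr -exprM [qhalf ^+ n]exprnP -expfzDr // exprnP; congr (_ ^ _).
by lia.
Qed.

(** The three parts of G_i are the half that does not wrap, the wrapped term j = 0 and the other
    wrapped terms; the middle one fits because q^(n/2) = q^(n-1) q^(-(n-2)/2). *)
Lemma G_cl i : (0 < i <= n.+1)%N -> G_ n q qhalf Y i * Bcl i = Ecl i * V i.
Proof.
case/andP=> i0 lei.
have pd k : 1 + (P (2 * (k + n.+1)))^-1 = 1 + (P (2 * k))^-1 by rewrite ph_even_period.
rewrite (@cycsum_unfold _ _ _ _ Ecl i lei (vratio_period X) pd Ecl_rec).
have termE j : (0 < j <= n)%N ->
   Bcl j * ((\prod_(j.+1 <= l < n.+1) qg Y l) / (\prod_(1 <= l < j) qg Y l)) * qf Y j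
   = Ecl j * (1 + (P (2 * j))^-1).
  case/andP=> j0 lej; rewrite -G_term //.
  have gE l : (0 < l)%N -> g_ n qhalf Y l = qg Y l by move=> l0; rewrite /g_ ifN //
    -lt0n.
  rewrite [\prod_(0 <= l < j) _]big_ltn //.
  rewrite (eq_big_nat _ _ (F2 := fun l => g_ n qhalf Y l)); last by move=> l /andP[l0
    _]; rewrite gE //; lia.
  rewrite [\prod_(1 <= l < j) _](eq_big_nat _ _ (F2 := fun l => g_ n qhalf Y l));
    last by move=> l /andP[l0 _]; rewrite gE //; lia.
  have -> : f_ Y j = qf Y j by rewrite /f_ ifN // -lt0n.
  have nz : g_ n qhalf Y 0 != 0 by rewrite (g_cl gX mXY) ?gcl0.
  congr (_ * _); rewrite -[RHS]mulrA; congr (_ * _).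
  by rewrite invfM mulrACA divff ?mul1r.
have splitB j : (i <= j)%N -> Bcl j = Bcl i * \prod_(i <= k < j) ba k.
  by move=> leij; rewrite /Bcl (big_cat_nat (leq0n i) leij).
rewrite [\sum_(0 <= j < i) _]big_ltn // mulrDr addrA /G_ !mulrDl; congr (_ + _ + _).
- rewrite mulr_suml; apply: eq_big_nat => j /andP[leij ltj].
  by rewrite -termE; [rewrite (splitB j leij); ring | lia].
- rewrite prod_vratio (splitB _ lei) qhalf_exp /Ecl big_ord0 muln0.
  by have nz := qhalf_exp_neq0; field; nonzero gX.
- rewrite mulr_sumr mulr_suml [RHS]mulr_sumr; apply: eq_big_nat => j /andP[j0 ltj].
  rewrite -termE; last by lia.
  by rewrite prod_vratio (splitB _ lei) -[\prod_(0 <= k < j) _]/(Bcl j); ring.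
Qed.

Lemma g_eq i : (0 < i <= n)%N ->
  qg Y i * gbar i
  = (F_ n Y i.+1 * G_ n q qhalf Y i) / (F_ n Y i * G_ n q qhalf Y i.+1).
Proof.
case/andP=> i0 lei.
have nzB := Bcl0 (leqW lei); have nzB' := Bcl0 (lei : (i.+1 <= n.+1)%N).
have GE : G_ n q qhalf Y i = Ecl i * V i / Bcl i.
  by rewrite -G_cl ?i0 ?(leqW lei) // mulfK.
have GE' : G_ n q qhalf Y i.+1 = Ecl i.+1 * V i.+1 / Bcl i.+1.
  by rewrite -G_cl // mulfK.
rewrite GE GE' !F_cl ?i0 ?(leqW lei) // /Fcl Ecl_rec Bcl_rec /gbar ph_tau_evenV //.
have -> : qg Y i = gc i by rewrite -(g_cl gX mXY lei) /g_ ifN // -lt0n.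
rewrite (b_cl' gX mXY) // (a_cl gX mXY) //.
have DE : Dcl i.+1 = Dcl i / (P (2 * i).+1 * P (2 * i).+2).
  rewrite /Dcl mulnS !big_ord_recr /=; have nz := prod_ph_neq0 gX (2 * i).
  by field; nonzero gX.
have nzD : Dcl i != 0.
  rewrite /Dcl; have nz := prod_ph_neq0 gX (2 * i); have nzt := t0 gX mXY.
  by nonzero gX.
have nzE := Ecl0 i; have nzV := Vsum_neq0 gX i; have nzV' := Vsum_neq0 gX i.+1.
have nzT := Tsum_neq0 gX (2 * i); have nzT' := Tsum_neq0 gX (2 * i).+2.
have nza := acl0 gX mXY i; have nzt := t0 gX mXY.
rewrite DE /gcl /bcl /vratio mulnS.
by field; nonzero gX.
Qed.

(* The quantity a_(i+1) (1 + alpha_(2i)/phi_(2i)) F_i F_(i+1) / f_i, with phi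
   evaluated after tau_1; by [Kcl_rec] it telescopes the product in fbar_i. *)
Definition Kcl i : F :=
  ac i * (1 + A (2 * i) / P'' (2 * i)) * Fcl i * Fcl i.+1 / fc i.

Lemma Dcl_rec i : Dcl i.+1 = Dcl i / (P (2 * i).+1 * P (2 * i).+2).
Proof.
rewrite /Dcl mulnS !big_ord_recr /=; have nz := prod_ph_neq0 gX (2 * i).
by field; nonzero gX.
Qed.

Lemma Dcl0 i : Dcl i != 0.
Proof.
rewrite /Dcl; have nz := prod_ph_neq0 gX (2 * i); have nzt := t0 gX mXY.
by nonzero gX.
Qed.

Lemma Fcl0 i : Fcl i != 0.
Proof.
have nzD := Dcl0 i; have nzT := Tsum_neq0 gX (2 * i); have nzt := t0 gX mXY.
by rewrite /Fcl; nonzero gX.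
Qed.

Lemma tau_even_add i :
  A (2 * i) / P'' (2 * i) = Se i / (ph (Wpt X) (2 * i).+1 * Se i.+1).
Proof.
rewrite ph_tau_even; have n1 := Seven_Wpt_neq0 gX i; have n2 := Seven_Wpt_neq0 gX i.+1.
have n3 : ph (Wpt X) (2 * i).+1 != 0 by apply: gX; apply: subfree_Wpt.
by field; nonzero gX.
Qed.

(** By [Seven_Sodd_Wpt], the factors 1 + alpha/phi at both ends bring in the odd sums at i and i+1,
    exactly those in the transformed phi_(2i+1), so they cancel. *)
Lemma Kcl_rec i : P'' (2 * i).+1 * P'' (2 * i).+2 * Kcl i.+1 = Kcl i.
Proof.
have k1 : 1 + A (2 * i) / P'' (2 * i)
    = (1 + wratio X i) * So i / (ph (Wpt X) (2 * i).+1 * Se i.+1).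
  rewrite tau_even_add -(Seven_Sodd_Wpt gX i); have n2 := Seven_Wpt_neq0 gX i.+1.
  have n3 : ph (Wpt X) (2 * i).+1 != 0 by apply: gX; apply: subfree_Wpt.
  by field; nonzero gX.
have k2 : P'' (2 * i).+2 * (1 + A (2 * i).+2 / P'' (2 * i).+2)
    = A (2 * i).+2 * ((1 + wratio X i.+1) * So i.+1) / Se i.+1.
  have E := ph_tau_even X i.+1; rewrite mulnS in E.
  have n1 := Seven_Wpt_neq0 gX i.+1.
  have -> : (1 + wratio X i.+1) * So i.+1 = Se i.+1 + ph (Wpt X) (2 * i.+1).+1 * Se
    i.+2.
    by rewrite Seven_Sodd_Wpt.
  rewrite mulrDr mulrCA divff ?P''0 // E !mulnS.
  by rewrite !mulnS in n1; field; nonzero gX.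
rewrite /Kcl k1 mulnS.
transitivity (P'' (2 * i).+1 * (P'' (2 * i).+2 * (1 + A (2 * i).+2 / P'' (2 * i).+2))
   * (ac i.+1 * Fcl i.+1 * Fcl i.+2 / fc i.+1)); first by rewrite add2n; ring.
rewrite k2 (ph_tau_odd gX) (W_odd gX) !(one_wratio gX) (aclE Y gX i) /bcl /Fcl
  !Dcl_rec !mulnS.
have fE := fcl_rec Y gX i; have nz : 1 + P (2 * i).+2 != 0 by nonzero gX.
rewrite -[fc i](mulfK nz) fE.
have nzf := fcl0 gX mXY i.+1; have nzD := Dcl0 i; have nza := acl0 gX mXY i.+1.
have n1 := Tsum_neq0 gX (2 * i).+1; have n2 := Tsum_neq0 gX (2 * i).+2.
have n3 := Tsum_neq0 gX (2 * i).+3; have n4 := Tsum_neq0 gX (2 * i).+4.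
have n0 := Tsum_neq0 gX (2 * i).
have nS := Sodd_Wpt_neq0 gX i; have nS' := Sodd_Wpt_neq0 gX i.+1; have nE' :=
  Seven_Wpt_neq0 gX i.+1.
rewrite (wratioE gX); rewrite !mulnS in nS' nE' *.
by field; nonzero gX.
Qed.

Lemma Kcl_tail i : (i <= n.+1)%N -> ph_tail X'' i * Kcl n.+1 = Kcl i.
Proof.
move=> lei; rewrite -(subKn lei); elim: (n.+1 - i)%N => [|k IH].
  by rewrite subn0 ph_tail_last mul1r.
case: (ltnP k n.+1) => ltkn; last by move: IH; have [-> ->]: (n.+1 - k.+1 = 0 /\ n.+1
  - k = 0)%N by lia.
set m := (n.+1 - k.+1)%N; have Em : (n.+1 - k = m.+1)%N by rewrite /m; lia.
have lemn : (m <= n)%N by rewrite /m; lia.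
by rewrite ph_tail_rec // -(Kcl_rec m); move: IH; rewrite Em => <-; ring.
Qed.

Lemma Fcl_period i : Fcl (i + n.+1) = Fcl i / qt Y.
Proof.
have nz : 1 + P (2 * i) != 0 by nonzero gX.
have DE k : Dcl k = fc k / (1 + P (2 * k)).
  by rewrite /Dcl /fcl; have nz' := prod_ph_neq0 gX (2 * k); field; nonzero gX.
rewrite /Fcl !DE (fcl_period gX mXY) ph_even_period mulnDr mulnS Tsum_period.
by ring.
Qed.

(** The quasi-periods 1/q of a and 1/t of F, with f_(n+1) = 1, produce the prefactor q t of the
    system. *)
Lemma Kcl_last : Kcl n.+1
  = ac 0 * (1 + A 0 / P'' 0) * Fcl n.+1 * Fcl 1 / (q * qt Y).
Proof.
rewrite /Kcl -[in ac n.+1](add0n n.+1) (acl_period gX mXY) (f_last gX mXY).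
rewrite -[Fcl n.+2]/(Fcl (1 + n.+1)) Fcl_period.
have -> : A (2 * n.+1) = A 0 by rewrite -(al_even_period X 0).
have -> : P'' (2 * n.+1) = P'' 0 by rewrite -(ph_even_period X'' 0).
have nq := q0 gX mXY; have nt := t0 gX mXY.
by have := P''0 0 => nP; field; nonzero gX.
Qed.

Lemma f_eq i : (0 < i <= n)%N ->
  qf Y i * fbar i
  = q * qt Y
    * ((F_ n Y i * F_ n Y i.+1 * (b_ n q Y i / gbar i - 1) * (gbar i - qa Y i.+1))
       / (F_ n Y n.+1 * F_ n Y 1 * (b_ n q Y 0 / gbar 0 - 1) * (gbar 0 - qa Y 1))).
Proof.
case/andP=> i0 lei; have nq := q0 gX mXY; have nt := t0 gX mXY.
have gX'' := generic_tau gX.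
rewrite /fbar.
have KE := Kcl_tail (leqW lei); rewrite Kcl_last in KE.
(* Since b_k/gbar_k is minus the transformed phi_(2k), the two factors supply 1 + phi_(2k) and the
   factor a_(k+1) (1 + alpha_(2k)/phi_(2k)) of [Kcl]. *)
have gE k : (k <= n)%N -> (b_ n q Y k / gbar k - 1) * (gbar k - qa Y k.+1)
    = (1 + P'' (2 * k)) * ac k * (1 + A (2 * k) / P'' (2 * k)).
  move=> lek; rewrite /gbar (b_cl' gX mXY lek) (a_cl gX mXY lek) /bcl.
  have nP := P''0 (2 * k); have nz := acl0 gX mXY k.
  by field; nonzero gX.
rewrite -![_ * (_ / gbar _ - 1) * _]mulrA !gE // !F_cl ?i0 ?(leqW lei) ?leqnn //.
have -> : qf Y i = fc i by rewrite -(f_cl gX mXY lei) /f_ ifN // -lt0n.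
have nzA k : 1 + A k / P'' k != 0 by rewrite -(al_tau X k); nonzero gX''.
have n1 := nzA 0; have n2 := Fcl0 n.+1; have n3 := Fcl0 1; have n4 := acl0 gX mXY 0.
have n5 := fcl0 gX mXY i; have n6 : 1 + P'' 0 != 0 by nonzero gX''.
have -> : ph_tail X'' i
    = Kcl i * (q * qt Y) / (ac 0 * (1 + A 0 / P'' 0) * Fcl n.+1 * Fcl 1).
  rewrite -KE; move: (1 + A 0 / P'' 0) n1 => x n1.
  by field; nonzero gX.
rewrite /Kcl muln0.
move: (1 + A 0 / P'' 0) n1 (1 + A _ / _) => x n1 y.
by field; nonzero gX.
Qed.

Lemma identified_ext Y1 (f g f' g' : nat -> F) :
  (forall i, (0 < i <= n)%N -> f i = f' i /\ g i = g' i) ->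
  identified q qhalf X'' (shifted q Y1 f g) ->
  identified q qhalf X'' (shifted q Y1 f' g').
Proof.
move=> E [H1 H2 Hf Hg H0]; split=> //.
- move=> i hi; have [e _] := E i hi; rewrite -[LHS]/(f' i) -e; exact: Hf.
- move=> i hi; have [_ e] := E i hi; rewrite -[qg _ i]/(g' i) -e; exact: Hg.
- rewrite -H0; congr (_ / _); rewrite /g_ /=; congr (_ * _)^-1.
  by apply: eq_big_nat => i hi; have [] := E i hi.
Qed.

Lemma shifted_unique f g : identified q qhalf X'' (shifted q Y f g) ->
  forall i, (0 < i <= n)%N -> fbar i = f i /\ gbar i = g i.
Proof.
have gX'' := generic_tau gX.
move=> /(identified_matched gX'') [_ _ _ fE gE] i /andP[i0 lei].
have := gE i lei; rewrite /g_ ifN -?lt0n // => gi; split=> //.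
move/(fext_closed _ gX''): fE => /(_ i (leqW lei)) fi.
by rewrite /fbar -fi /fext ifN /f_ ?ifN -?lt0n // neq_ltn ltnS lei.
Qed.

Lemma g0_bar : g_ n qhalf (shifted q Y fbar gbar) 0 = gbar 0.
Proof. by have [_ _ _ _ ->] := shifted_matched. Qed.

(** The right-hand sides of the g-equations involve only [Y], so these fix the shifted g_i and hence
    the shifted g_0; the f-equations then fix the shifted f_i. The identification fixes them by its
    closed forms, and [fbar], [gbar] satisfy both. *)
Lemma tau_system f g :
  identified q qhalf X'' (shifted q Y f g) <-> qP_system n q qhalf Y f g.
Proof.
have sys : qP_system n q qhalf Y fbar gbar.
  by move=> i hi; rewrite g0_bar; split; [apply: f_eq | apply: g_eq].
split=> [id|sysfg].
  have E := shifted_unique id.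
  have g0E : g_ n qhalf (shifted q Y f g) 0 = g_ n qhalf (shifted q Y fbar gbar) 0.
    by rewrite /g_ /=; congr (_ * _)^-1; apply: eq_big_nat => i hi; have [_ ->] := E
      i hi.
  move=> i hi; rewrite g0E; have [Ef Eg] := E i hi.
  by have := sys i hi; rewrite Ef Eg.
have gE i : (0 < i <= n)%N -> gbar i = g i.
  move=> hi; have [_ e1] := sys i hi; have [_ e2] := sysfg i hi.
  have /andP[i0 lei] := hi.
  have nz : qg Y i != 0.
    have -> : qg Y i = gc i by rewrite -(g_cl gX mXY lei) /g_ ifN // -lt0n.
    exact: gcl0.
  by apply: (mulfI nz); rewrite e1 e2.
have g0E : g_ n qhalf (shifted q Y f g) 0 = g_ n qhalf (shifted q Y fbar gbar) 0.
  by rewrite /g_ /=; congr (_ * _)^-1; apply: eq_big_nat => i hi; rewrite gE.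
apply: identified_ext shifted_identified => i hi; split; last exact: gE.
have [e1 _] := sys i hi; have [e2 _] := sysfg i hi; have /andP[i0 lei] := hi.
have nz : qf Y i != 0.
  have -> : qf Y i = fc i by rewrite -(f_cl gX mXY lei) /f_ ifN // -lt0n.
  exact: (fcl0 gX mXY).
by apply: (mulfI nz); rewrite e1 e2 g0E gE.
Qed.

End Tau1System.

Theorem theorem5p1 (n : nat) (hn : (1 <= n)%N)
    (L : fieldType) (iota : {rmorphism QAlphaPhi n -> L})
    (q qhalf qroot : L) (hhalf : qhalf ^+ 2 = q) (hroot : qroot ^+ n.+1 = q)
    (Y : qpoint L)
    (hY : identified q qhalf (apoint_map iota (generators n)) Y) :
  [/\ (exists fbar gbar : nat -> L,
         identified q qhalf (apoint_map iota (tau1 (generators n)))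
           (shifted q Y fbar gbar)),
      (forall fbar gbar : nat -> L,
         identified q qhalf (apoint_map iota (tau1 (generators n)))
           (shifted q Y fbar gbar)
         <-> qP_system n q qhalf Y fbar gbar),
      (forall j : 'I_(2 * n).+2,
         identified q qhalf (apoint_map iota (r j (generators n)))
           (rt n q qhalf j Y))
    & identified q qhalf (apoint_map iota (s1' (pi_ (generators n))))
        (pit n q qhalf qroot Y)].
Proof.
have gX : generic (apoint_map iota (generators n)).
  by apply: generic_map; apply: generic_generators.
have mXY := identified_matched gX hY; have rhoY := identified_rho hY.
rewrite apoint_map_tau1; split.
- by do 2!eexists; apply: shifted_identified.
- by move=> f g; apply: tau_system.
- by move=> j; rewrite apoint_map_r; apply: r_identified.
- rewrite apoint_map_s1' -[apoint_map iota (pi_ _)]/(pi_ (apoint_map iota (generators n))).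
  exact: pit_identified.
Qed.
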